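(* Let $\epsilon \ge 0$ and let $X$ be a non-degenerate real-valued random variable with $E[X]=0$ and $E[X^2]<\infty$. Then there exists a minimizer $Y \in \mathcal{V}_{\epsilon}(X)$ such that $$\mathrm{var}\, E[X\mid X+Y] = \inf_{Z \in \mathcal{V}_{\epsilon}(X)} \mathrm{var}\, E[X\mid X+Z] = L(X,\epsilon).$$ Consequently, the least favorable noise exists.
   Context: For a real-valued square-integrable random variable $X$ with mean $0$ and a real number $\epsilon \ge 0$, define $$\mathcal{V}_{\epsilon}(X) := \{ Y : Y \text{ is a real-valued random variable independent of } X,\ E[Y]=0 \text{ and } E[Y^2]\le \epsilon^2\},$$ $$L(X,\epsilon) := \inf_{Y\in \mathcal{V}_{\epsilon}(X)} \mathrm{var}\, E[X\mid X+Y].$$ A least favorable noise $\hat Y_\epsilon$ for $X$ is a $Y\in\mathcal{V}_\epsilon(X)$ for which $\mathrm{var}\,E[X\mid X+Y]=L(X,\epsilon)$. Here $E[X\mid X+Y]$ is the conditional expectation of $X$ given $\sigma(X+Y)$. Non-degenerate means not almost surely constant. Convention: the underlying probability space is allowed to be enlarged, so that random variables with any prescribed law independent of the given ones are available. Since $\mathrm{var}\,E[X\mid X+Y]$ depends only on the joint law of $(X,Y)$, membership in $\mathcal{V}_\epsilon(X)$ and the infimum may equivalently be understood as ranging over all probability laws of $Y$ on $\mathbb{R}$ with mean $0$ and second moment at most $\epsilon^2$, with $(X,Y)$ having the product law. *)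

(* Defs.v *)
(* MathComp / MathComp-Analysis *)
From HB Require Import structures.
From mathcomp Require Import all_boot all_order all_algebra.
From mathcomp Require Import all_classical all_reals all_analysis.

Set Implicit Arguments.
Unset Strict Implicit.
Unset Printing Implicit Defensive.

Import Order.TTheory GRing.Theory Num.Theory.
Import numFieldNormedType.Exports.

Local Open Scope classical_set_scope.
Local Open Scope ring_scope.
Local Open Scope ereal_scope.

Definition independent_rvs {d} {T : measurableType d} {R : realType}
    (P : probability T R) (X Y : T -> R) : Prop :=
  forall A B : set R, measurable A -> measurable B ->
    P (X @^-1` A `&` Y @^-1` B) = P (X @^-1` A) * P (Y @^-1` B).

Definition nondegenerate_rv {d} {T : measurableType d} {R : realType}
    (P : probability T R) (X : T -> R) : Prop :=
  ~ exists c : R, {ae P, forall w, X w = c}.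

(* [Z] is a version of E[X | sigma(W)]. *)
Definition is_cond_exp {d} {T : measurableType d} {R : realType}
    (P : probability T R) (X W Z : T -> R) : Prop :=
  [/\ measurable_fun [set: g_sigma_algebra_preimageType W] Z,
      P.-integrable [set: T] (EFin \o Z) &
      forall A : set T, g_sigma_algebra_preimage W A ->
        \int[P]_(w in A) (Z w)%:E = \int[P]_(w in A) (X w)%:E].

(* Versions exist when [W] is measurable and [X] integrable (Radon-Nikodym) and
   are almost surely equal, so the variance of [cond_exp] does not depend on
   the choice made by [xget]; the default value [cst 0] is then never used. *)
Definition cond_exp {d} {T : measurableType d} {R : realType}
    (P : probability T R) (X W : T -> R) : T -> R :=
  xget (cst 0%R) [set Z | is_cond_exp P X W Z].

(* An enlargement of the probability space (T, P): a random variable [X] on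
   (T, P) lives on the enlarged space as [X \o ext_proj]. *)
Record enlargement {d} {T : measurableType d} {R : realType}
    (P : probability T R) := Enlargement {
  ext_disp : measure_display;
  ext_space : measurableType ext_disp;
  ext_prob : probability ext_space R;
  ext_proj : {mfun ext_space >-> T};
  ext_projP : forall A : set T, measurable A ->
    ext_prob (ext_proj @^-1` A) = P A }.

(* A noise is a real random variable on some enlargement of (T, P). *)
Record noise {d} {T : measurableType d} {R : realType}
    (P : probability T R) := Noise {
  noise_ext : enlargement P;
  noise_rv : {RV (ext_prob noise_ext) >-> R} }.
Arguments noise_rv {d T R P} _.

Section least_favorable_noise.
Context {d} {T : measurableType d} {R : realType} {P : probability T R}.
Implicit Types (X : {RV P >-> R}) (Y : noise P) (eps : R).

Definition noise_prob Y : probability (ext_space (noise_ext Y)) R :=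
  ext_prob (noise_ext Y).

Definition lift_rv X Y : ext_space (noise_ext Y) -> R :=
  X \o ext_proj (noise_ext Y).
Arguments lift_rv X Y _ : clear implicits.

Definition noise_class X eps Y : Prop :=
  [/\ independent_rvs (noise_prob Y) (lift_rv X Y) (noise_rv Y),
      'E_(noise_prob Y)[noise_rv Y] = 0 &
      'E_(noise_prob Y)[fun w => (noise_rv Y w ^+ 2)%R] <= (eps ^+ 2)%:E].

(* var E[X | X + Y] *)
Definition var_cond_exp X Y : \bar R :=
  'V_(noise_prob Y)[cond_exp (noise_prob Y) (lift_rv X Y)
                             (lift_rv X Y \+ noise_rv Y)%R].

(* [noise P] is too large a type for [set (noise P)] and the image notation,
   hence the explicit existential. *)
Definition least_var_cond_exp X eps : \bar R :=
  ereal_inf [set v | exists2 Z : noise P, noise_class X eps Z &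
                                          v = var_cond_exp X Z].

Definition least_favorable X eps Y : Prop :=
  noise_class X eps Y /\ var_cond_exp X Y = least_var_cond_exp X eps.

End least_favorable_noise.

(* Main.v *)
Require Import Defs.
From HB Require Import structures.
From mathcomp Require Import all_boot all_order all_algebra.
From mathcomp Require Import all_classical all_reals all_analysis.
From mathcomp Require Import measurable_realfun.
From mathcomp Require Import ring lra.

(** The variance of E[X | W] is the supremum, over bounded continuous f, of
    the gain

      E [2 X f(W) - f(W)^2] = E [X^2] - E [(X - f(W))^2],

    because E[X | W] is the orthogonal projection of X on the square
    integrable functions of W and the functions f(W), f bounded continuous,
    are dense among those ([gain_le_var], [var_le_gain]).  For a fixed f the
    gain of W = X + Y is continuous under almost sure convergence of Y, so the
    variance is lower semicontinuous in the law of Y.  It remains to extract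
    from a minimizing sequence of noises a subsequence that converges to an
    admissible noise.

    The gain depends on the noise only through its law, so a noise may be
    replaced by Q(U), where Q is its quantile function and U is uniform on
    [0, 1] and independent of X; this pair lives on the product of (T, P) with
    the uniform probability ([noise_class_quantile]).  Working with quantile
    functions turns convergence in law into convergence almost everywhere on
    one fixed space.  The quantile functions Q_n of a minimizing sequence are
    nondecreasing, and the bound on the second moments bounds them pointwise
    on ]0, 1[ ([nondecreasing_pointwise_bound]); Helly's selection theorem
    ([helly_selection]) provides a subsequence converging almost everywhere to
    some Q.

    The limit is admissible: E [Q(U)^2] <= eps^2 by Fatou's lemma, and
    E [Q(U)] = 0 because bounded second moments give uniform integrability
    ([moments_limit]).  For every f the gain of X + Q_n(U) is at most the n-th
    term of the minimizing sequence and converges, by dominated convergence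
    ([uniform_gain_cvg]), to the gain of X + Q(U), which is therefore at most
    the infimum.  Taking the supremum over f shows that Q(U) attains it. *)

Set Implicit Arguments.
Unset Strict Implicit.
Unset Printing Implicit Defensive.

Import Order.TTheory GRing.Theory Num.Theory.
Import numFieldNormedType.Exports.

Local Open Scope classical_set_scope.
Local Open Scope ring_scope.

(** * Integration on a probability space *)

Local Notation L1 P f := (P.-integrable [set: _] (EFin \o f)).

Section integrability.
Context {d} {T : measurableType d} {R : realType} (P : probability T R).
Implicit Types f g u : T -> R.

Lemma L1_measurable f : L1 P f -> measurable_fun [set: T] f.
Proof. by move=> /measurable_int/measurable_EFinP. Qed.

Lemma L1_eq f g : f =1 g -> L1 P f -> L1 P g.
Proof. by move=> /funext ->. Qed.

Lemma L1D f g : L1 P f -> L1 P g -> L1 P (fun x => f x + g x).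
Proof. by move=> If Ig; have := integrableD measurableT If Ig. Qed.

Lemma L1Z (a : R) f : L1 P f -> L1 P (fun x => a * f x).
Proof. by move=> If; have := integrableZl measurableT a If. Qed.

Lemma L1B f g : L1 P f -> L1 P g -> L1 P (fun x => f x - g x).
Proof. by move=> If Ig; have := integrableB measurableT If Ig. Qed.

Lemma L1_le f g : measurable_fun [set: T] f -> L1 P g ->
  (forall x, `|f x| <= g x) -> L1 P f.
Proof.
move=> mf Ig fg; apply: le_integrable Ig => //; first exact/measurable_EFinP.
by move=> x _ /=; rewrite lee_fin (le_trans (fg x))// ler_norm.
Qed.

Lemma L1_cst (a : R) : L1 P (fun=> a).
Proof. exact: finite_measure_integrable_cst. Qed.

Lemma L1_bounded f M : measurable_fun [set: T] f ->
  (forall x, `|f x| <= M) -> L1 P f.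
Proof. by move=> mf fM; apply: L1_le mf (L1_cst M) fM. Qed.

Lemma L1_mulbounded f u M : L1 P f -> measurable_fun [set: T] u ->
  (forall x, `|u x| <= M) -> L1 P (fun x => f x * u x).
Proof.
move=> If mu uM.
apply: (@L1_le _ (fun x => M * `|f x|)).
- by apply: measurable_funM => //; exact: L1_measurable.
- by apply: L1Z; exact: integrable_norm If.
- by move=> x; rewrite normrM mulrC ler_wpM2r.
Qed.

Lemma L1_bounded_sqr f M : measurable_fun [set: T] f ->
  (forall x, `|f x| <= M) -> L1 P (fun x => f x ^+ 2).
Proof. by move=> mf fM; exact: L1_mulbounded (L1_bounded mf fM) mf fM. Qed.

Lemma L1_sqr f : measurable_fun [set: T] f ->
  L1 P (fun x => f x ^+ 2) -> L1 P f.
Proof.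
move=> mf If; apply: L1_le mf (L1D (L1_cst 1) If) _ => x /=.
have : 0 <= (`|f x| - 1) ^+ 2 by exact: sqr_ge0.
have := normr_ge0 (f x); rewrite -(real_normK (num_real (f x))).
by nra.
Qed.

Lemma L1_sqrP f : measurable_fun [set: T] f ->
  (\int[P]_x (f x ^+ 2)%:E < +oo)%E -> L1 P (fun x => f x ^+ 2).
Proof.
move=> mf foo; apply/integrableP; split.
  by apply/measurable_EFinP; exact: measurable_funX.
by under eq_integral do rewrite /= ger0_norm ?sqr_ge0//.
Qed.

Lemma RintegralE f : L1 P f -> (\int[P]_x f x)%:E = (\int[P]_x (f x)%:E)%E.
Proof. by move=> If; rewrite /Rintegral fineK//; exact: integrable_fin_num. Qed.

Lemma RintD f g : L1 P f -> L1 P g ->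
  \int[P]_x (f x + g x) = \int[P]_x f x + \int[P]_x g x.
Proof. exact: RintegralD. Qed.

Lemma RintB f g : L1 P f -> L1 P g ->
  \int[P]_x (f x - g x) = \int[P]_x f x - \int[P]_x g x.
Proof. exact: RintegralB. Qed.

Lemma RintZ (a : R) f : L1 P f ->
  \int[P]_x (a * f x) = a * \int[P]_x f x.
Proof. by move=> If; rewrite -RintegralZl. Qed.

Lemma Rint_cst (a : R) : \int[P]_x a = a.
Proof. by rewrite Rintegral_cst//= probability_setT/= mulr1. Qed.

Lemma Rint_le f g : L1 P f -> L1 P g -> (forall x, f x <= g x) ->
  \int[P]_x f x <= \int[P]_x g x.
Proof. by move=> If Ig fg; exact: le_Rintegral. Qed.

Lemma Rint_dominated_cvg (u : nat -> T -> R) f g :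
  (forall n, measurable_fun [set: T] (u n)) -> measurable_fun [set: T] f ->
  L1 P g -> (forall n x, `|u n x| <= g x) ->
  {ae P, forall x, u ^~ x @ \oo --> f x} ->
  L1 P f /\ \int[P]_x u n x @[n --> \oo] --> \int[P]_x f x.
Proof.
move=> mu mf Ig ug uf.
have [|||//||If _ uI] := @dominated_convergence _ _ _ P [set: T] measurableT
    (fun n => EFin \o u n) (EFin \o f) (EFin \o g).
- by move=> n; exact/measurable_EFinP.
- exact/measurable_EFinP.
- by apply: filterS uf => x ux _; apply: cvg_EFin => //; exact: nearW.
- by apply: aeW => x n _ /=; rewrite lee_fin.
split => //; apply: fine_cvg => /=.
by rewrite fineK //; exact: integrable_fin_num.
Qed.

Lemma measurable_lim (u : nat -> T -> R) f :
  (forall n, measurable_fun [set: T] (u n)) ->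
  (forall x, u ^~ x @ \oo --> f x) -> measurable_fun [set: T] f.
Proof.
move=> mu uf; apply/measurable_EFinP.
apply: (@emeasurable_fun_cvg _ _ _ _ (fun n => EFin \o u n)).
  by move=> n; exact/measurable_EFinP.
by move=> x _; apply: cvg_EFin (uf x); exact: nearW.
Qed.

(** Fatou's lemma in the form in which it serves here: an upper bound on
    integrals survives an almost sure limit of nonnegative functions. *)
Lemma fatou_le (u : nat -> T -> R) f (c : R) :
  (forall n, measurable_fun [set: T] (u n)) -> measurable_fun [set: T] f ->
  (forall n x, 0 <= u n x) -> (forall x, 0 <= f x) ->
  {ae P, forall x, u ^~ x @ \oo --> f x} ->
  (forall n, \int[P]_x (u n x)%:E <= c%:E)%E ->
  (\int[P]_x (f x)%:E <= c%:E)%E.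
Proof.
move=> mu mf u0 f0 uf uc.
have mEu n : measurable_fun [set: T] (EFin \o u n) by exact/measurable_EFinP.
apply: (@le_trans _ _ (\int[P]_x limn_einf (fun n => (u n x)%:E))%E).
  apply: ae_ge0_le_integral => //.
  - by move=> x _; rewrite lee_fin.
  - exact: measurableT_comp.
  - move=> x _; rewrite limn_einf_lim.
    apply: lime_ge; first exact: is_cvg_einfs.
    apply: nearW => n; apply: le_ereal_inf_tmp => _ [m _ <-].
    by rewrite lee_fin.
  - rewrite (_ : (fun x => _) =
        -%E \o (fun x => limn_esup (fun n => - (u n x)%:E)%E)) //.
    apply: measurableT_comp => //.
    apply: (measurable_fun_limn_esup (f := fun n x => - (u n x)%:E)%E) => n.
    exact: (measurableT_comp (@oppe_measurable R setT) (mEu n)).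
  - apply: filterS uf => x ux _.
    have /cvg_limn_einf_sup[-> _] : (u n x)%:E @[n --> \oo] --> (f x)%:E.
      by apply: cvg_EFin ux; exact: nearW.
    by [].
apply: (@le_trans _ _ (limn_einf (fun n => \int[P]_x (u n x)%:E))%E).
  by apply: (fatou P measurableT mEu) => n x _; rewrite /= lee_fin.
rewrite limn_einf_lim; apply: lime_le; first exact: is_cvg_einfs.
apply: nearW => n; apply: le_trans (uc n).
by apply: ereal_inf_lbound; exists n => /=.
Qed.

End integrability.

Import HBNNSimple.

(** An induction principle for bounded measurable functions: a property stable
    under linear combinations and bounded pointwise limits needs to be checked
    on indicators only, since a nonnegative measurable function is the
    increasing limit of simple functions. *)
Lemma bounded_measurable_ind d (T : measurableType d) (R : realType)
    (S : (T -> R) -> Prop) :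
  (forall A, measurable A -> S \1_A) ->
  (forall (a : R) f g, S f -> S g -> S (fun x => a * f x + g x)) ->
  (forall (M : R) (u : nat -> T -> R) (f : T -> R), (forall n, S (u n)) ->
     (forall n x, `|u n x| <= M) -> (forall x, u ^~ x @ \oo --> f x) -> S f) ->
  forall (M : R) (f : T -> R), measurable_fun [set: T] f ->
    (forall x, `|f x| <= M) -> S f.
Proof.
move=> S1 SD Slim.
have S0 : S (fun=> 0).
  have := S1 set0 measurable0; rewrite indic0.
  exact.
(* Adding the constant M reduces the claim to nonnegative functions. *)
suff pos (M : R) (f : T -> R) : measurable_fun [set: T] f ->
    (forall x, 0 <= f x <= M) -> S f.
  move=> M f mf fM.
  have := SD (- M) _ _ (S1 _ measurableT)
    (pos (M + M) (fun x => M + f x) _ _).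
  have -> : (fun x : T => - M * \1_[set: T] x + (M + f x)) = f.
    by apply/funext => x; rewrite indicT /= mulr1 addrA addNr add0r.
  apply.
    exact: measurable_funD.
  by move=> x; have := fM x; rewrite ler_norml => /andP[? ?]; lra.
move=> mf fM.
pose g := nnsfun_approx measurableT ((measurable_EFinP _ _).2 mf).
have gf x : g n x @[n --> \oo] --> f x.
  apply: (@fine_cvg _ _ _ _ (fun n => (g n x)%:E)).
  by apply: cvg_nnsfun_approx => // y _ /=; rewrite lee_fin; case/andP: (fM y).
have gle n x : g n x <= f x.
  apply: cvgr_to_ge (gf x) _; exists n => //= m nm.
  by apply/lefP; exact: nd_nnsfun_approx.
apply: (Slim M (fun n => g n : T -> R)) => //; last first.
  move=> n x; rewrite ger0_norm//; apply: le_trans (gle n x) _.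
  by case/andP: (fM x).
move=> n.
have -> : (g n : T -> R) = fun x => \sum_(y <- finmap.enum_fset
    (fset_set (range (g n)))) (y * \1_(g n @^-1` [set y]) x).
  by apply/funext => x; rewrite fimfunE fsbig_finite.
elim: (finmap.enum_fset _) => [|y s IH].
  by under eq_fun do rewrite big_nil.
under eq_fun do rewrite big_cons.
by apply: SD => //; exact/S1.
Qed.

(** * Conditional expectation *)

Section cond_exp_exists.
Context {d} {T : measurableType d} {R : realType} (P : probability T R).
Variables (X : T -> R) (W : {mfun T >-> R}).
Hypothesis IX : L1 P X.

Let mu : probability R R := distribution P W.
Let nu : {charge set R -> \bar R} :=
  measure_function_pushforward__canonical__charge_Charge
    (charge_induced_charge__canonical__charge_Charge IX) (measurable_funPT W).

Let numu : nu `<< mu.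
Proof.
apply/null_content_dominatesP => A mA muA.
rewrite /nu/= /pushforward /induced_charge.
apply: null_set_integral => //; first exact: measurable_funPTI.
by apply: measurable_funTS; apply/measurable_int; exact: IX.
Qed.

(** With mu the law of W, the charge nu B = E [X ; W \in B] on the Borel sets
    of R is dominated by mu.  If g is its Radon-Nikodym derivative, then g(W)
    is a version of E[X | W]; differentiating on the side of R makes the
    measurability with respect to W immediate. *)
Lemma cond_exp_exists : exists Z, is_cond_exp P X W Z.
Proof.
pose g := Radon_Nikodym nu mu.
have Ig : mu.-integrable [set: R] g by exact: Radon_Nikodym_integrable.
have mg : measurable_fun [set: R] g by exact: measurable_int Ig.
have gfin y : g y \is a fin_num by exact: Radon_Nikodym_fin_num.
have gWE : EFin \o (fine \o g \o W) = g \o W.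
  by apply/funext => w /=; rewrite fineK.
have IgW : P.-integrable [set: T] (g \o W).
  apply/integrableP; split; first exact: measurableT_comp.
  case/integrableP: Ig => _; rewrite ge0_integral_pushforward//.
  exact: measurableT_comp.
exists (fine \o g \o W); split.
- move=> _ B mB; exists ((fine \o g) @^-1` B).
    rewrite -[_ @^-1` _]setTI.
    by apply: measurableT_comp mg _ _ mB.
  by [].
- by rewrite gWE.
- move=> _ [B mB <-]; rewrite setTI.
  transitivity (\int[P]_(w in W @^-1` B) ((g \o W) w))%E.
    by apply: eq_integral => w _; rewrite /= fineK.
  rewrite -integral_pushforward//.
    by rewrite -(Radon_Nikodym_integral numu).
  apply: integrableS IgW => //.
  exact: measurable_funPTI.
Qed.

End cond_exp_exists.

Section tower.
Context {d} {T : measurableType d} {R : realType} (P : probability T R).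
Variables (X W : T -> R).
Hypotheses (mW : measurable_fun [set: T] W) (IX : L1 P X).

Lemma preimage_measurable A : g_sigma_algebra_preimage W A -> measurable A.
Proof. by move=> [B mB <-]; exact: mW. Qed.

Lemma preimage_measurable_fun (U : T -> R) :
  measurable_fun [set: g_sigma_algebra_preimageType W] U ->
  measurable_fun [set: T] U.
Proof. by move=> mU _ B mB; apply: preimage_measurable; exact: mU. Qed.

(** The defining property of the conditional expectation is this equality for
    indicators of events of sigma(W); both sides are linear in U and continuous
    for bounded pointwise convergence. *)
Lemma cond_exp_mul (Z : T -> R) : is_cond_exp P X W Z ->
  forall (M : R) (U : T -> R),
    measurable_fun [set: g_sigma_algebra_preimageType W] U ->
    (forall w, `|U w| <= M) ->
  \int[P]_w (Z w * U w) = \int[P]_w (X w * U w).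
Proof.
move=> [mZ IZ ZX].
pose S (U : T -> R) := [/\ measurable_fun [set: T] U,
  (exists M : R, forall w, `|U w| <= M) &
  \int[P]_w (Z w * U w) = \int[P]_w (X w * U w)].
suff H : forall (M : R) (U : T -> R),
    measurable_fun [set: g_sigma_algebra_preimageType W] U ->
    (forall w, `|U w| <= M) -> S U.
  by move=> M U mU UM; have [] := H M U mU UM.
apply: (@bounded_measurable_ind _ (g_sigma_algebra_preimageType W) R S).
- move=> A mA; have mA' := preimage_measurable mA; split.
  + exact: measurable_indic.
  + by exists 1 => w; rewrite indicE; case: (_ \in _); rewrite ?normr1 ?normr0.
  + have h (f : T -> R) : \int[P]_w (f w * \1_A w) = \int[P]_(w in A) f w.
      by rewrite [RHS]Rintegral_mkcond patch_indic.
    by rewrite !h /Rintegral ZX.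
- move=> a U V [mU [M UM] EU] [mV [N VN] EV]; split.
  + by apply: measurable_funD => //; exact: measurable_funM.
  + exists (`|a| * M + N) => w; rewrite (le_trans (ler_normD _ _))// normrM.
    by rewrite lerD// ler_wpM2l.
  + have h f : L1 P f -> \int[P]_w (f w * (a * U w + V w)) =
      a * \int[P]_w (f w * U w) + \int[P]_w (f w * V w).
      move=> If; have IU := L1_mulbounded If mU UM.
      have IV := L1_mulbounded If mV VN.
      rewrite -RintZ// -RintD//; last exact: L1Z.
      by apply: eq_Rintegral => w _; rewrite mulrDr mulrCA.
    by rewrite !h// EU EV.
- move=> M u U Su uM uU.
  have mU : measurable_fun [set: T] U.
    by apply: (@measurable_lim _ T R u _ _ uU) => n; have [] := Su n.
  have UM w : `|U w| <= M.
    by apply: cvgr_to_le (cvg_norm (uU w)) _; exact: nearW.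
  split => //; first by exists M.
  have h f : L1 P f ->
      \int[P]_w (f w * u n w) @[n --> \oo] --> \int[P]_w (f w * U w).
    move=> If; apply: (Rint_dominated_cvg (u := fun n w => f w * u n w)
      (g := fun w => M * `|f w|) _ _ _ _ _).2.
    + move=> n; apply: measurable_funM; first exact: L1_measurable If.
      by have [] := Su n.
    + by apply: measurable_funM => //; exact: L1_measurable If.
    + by apply: L1Z; exact: integrable_norm If.
    + by move=> n w; rewrite normrM mulrC ler_wpM2r.
    + by apply: aeW => w; apply: cvgM; [exact: cvg_cst|exact: uU].
  have hX := h _ IX.
  have hZ := h _ IZ.
  have E : (fun n => \int[P]_w (Z w * u n w)) =
           (fun n => \int[P]_w (X w * u n w)).
    by apply/funext => n; have [_ _ ->] := Su n.
  by rewrite E in hZ; exact: cvg_unique hZ hX.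
Qed.

End tower.

(** * Density of the continuous functions of W *)

Definition bounded_continuous (R : realType) (f : R -> R) :=
  continuous f /\ exists M, forall x, `|f x| <= M.

Section density.
Context {d} {T : measurableType d} {R : realType} (P : probability T R).
Variables (W : T -> R).
Hypotheses (mW : measurable_fun [set: T] W).

(** Membership, among the bounded functions, in the closure in L^2(P) of the
    functions f(W) with f bounded continuous. *)
Definition approximable (U : T -> R) := [/\ measurable_fun [set: T] U,
  (exists M : R, forall w, `|U w| <= M) &
  forall e : R, 0 < e -> exists2 f : R -> R, bounded_continuous f &
    \int[P]_w ((U w - f (W w)) ^+ 2) <= e].

Lemma bounded_continuous_comp (f : R -> R) : bounded_continuous f ->
  measurable_fun [set: T] (f \o W).
Proof.
move=> [cf _]; apply: measurableT_comp => //.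
exact: continuous_measurable_fun.
Qed.

Lemma L1_sqrB (U V : T -> R) (M N : R) :
  measurable_fun [set: T] U -> measurable_fun [set: T] V ->
  (forall w, `|U w| <= M) -> (forall w, `|V w| <= N) ->
  L1 P (fun w => (U w - V w) ^+ 2).
Proof.
move=> mU mV UM VN; apply: (@L1_bounded _ _ _ _ _ ((M + N) ^+ 2)).
  by apply: measurable_funX; exact: measurable_funB.
move=> w; rewrite normrX lerXn2r ?nnegrE//.
  by rewrite (le_trans _ (lerD (UM w) (VN w)))// addr_ge0.
by rewrite (le_trans (ler_normB _ _))// lerD.
Qed.

(** Follows from (x + y)^2 <= 2 x^2 + 2 y^2; the tolerance given to U is
    divided by a^2 + 1 so as to remain meaningful when a = 0. *)
Lemma approximable_lin (a : R) U V : approximable U -> approximable V ->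
  approximable (fun w => a * U w + V w).
Proof.
move=> [mU [M UM] aU] [mV [N VN] aV]; split.
- by apply: measurable_funD => //; exact: measurable_funM.
- exists (`|a| * M + N) => w; rewrite (le_trans (ler_normD _ _))// normrM.
  by rewrite lerD// ler_wpM2l.
move=> e e0.
have a1 : 0 < 4 * (a ^+ 2 + 1) by have := sqr_ge0 a; lra.
have [f [cf [K fK]] Uf] := aU (e / (4 * (a ^+ 2 + 1))) (divr_gt0 e0 a1).
have e40 : 0 < e / 4 by rewrite divr_gt0.
have [g [cg [L gL]] Vg] := aV (e / 4) e40.
have mf := bounded_continuous_comp (conj cf (ex_intro _ K fK)).
have mg := bounded_continuous_comp (conj cg (ex_intro _ L gL)).
exists (fun x => a * f x + g x).
  split.
    move=> x; apply: cvgD; last exact: cg.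
    by apply: cvgM; [exact: cvg_cst|exact: cf].
  exists (`|a| * K + L) => x; rewrite (le_trans (ler_normD _ _))// normrM.
  by rewrite lerD// ler_wpM2l.
have IU := L1_sqrB mU mf UM (fun w => fK (W w)).
have IV := L1_sqrB mV mg VN (fun w => gL (W w)).
apply: (@le_trans _ _ (\int[P]_w (2 * a ^+ 2 * (U w - f (W w)) ^+ 2 +
                                  2 * (V w - g (W w)) ^+ 2))).
  apply: Rint_le.
  - apply: (@L1_sqrB (fun w => a * U w + V w) (fun w => a * f (W w) + g (W w))
      (`|a| * M + N) (`|a| * K + L)).
    + by apply: measurable_funD => //; exact: measurable_funM.
    + by apply: measurable_funD => //; exact: measurable_funM.
    + move=> w; rewrite (le_trans (ler_normD _ _))// normrM.
      by rewrite lerD// ler_wpM2l.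
    + move=> w; rewrite (le_trans (ler_normD _ _))// normrM.
      by rewrite lerD// ler_wpM2l.
  - by apply: L1D; exact: L1Z.
  - move=> w; have := sqr_ge0 (a * (U w - f (W w)) - (V w - g (W w))).
    by nra.
rewrite RintD; [|exact: L1Z|exact: L1Z].
rewrite !RintZ//.
have : 2 * a ^+ 2 * \int[P]_w ((U w - f (W w)) ^+ 2) <= e / 2.
  apply: (@le_trans _ _ (2 * a ^+ 2 * (e / (4 * (a ^+ 2 + 1))))).
    by rewrite ler_wpM2l// mulr_ge0// sqr_ge0.
  rewrite mulrA ler_pdivrMr//; have := sqr_ge0 a; nra.
by lra.
Qed.

(** Bounded pointwise convergence implies convergence in L^2. *)
Lemma approximable_lim (M : R) (u : nat -> T -> R) (U : T -> R) :
  (forall n, approximable (u n)) -> (forall n w, `|u n w| <= M) ->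
  (forall w, u ^~ w @ \oo --> U w) -> approximable U.
Proof.
move=> au uM uU.
have mu n : measurable_fun [set: T] (u n) by have [] := au n.
have mU : measurable_fun [set: T] U by exact: measurable_lim mu uU.
have UM w : `|U w| <= M.
  by apply: cvgr_to_le (cvg_norm (uU w)) _; exact: nearW.
split => //; first by exists M.
move=> e e0.
have e40 : 0 < e / 4 by rewrite divr_gt0.
have [_ uU0] : L1 P (fun=> 0) /\
    \int[P]_w ((U w - u n w) ^+ 2) @[n --> \oo] --> \int[P]_w (0 : R).
  apply: (@Rint_dominated_cvg _ _ _ _ (fun n w => (U w - u n w) ^+ 2)
    (fun=> 0) (fun=> (M + M) ^+ 2)).
  - by move=> n; apply: measurable_funX; exact: measurable_funB.
  - exact: measurable_cst.
  - exact: L1_cst.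
  - move=> n w; rewrite normrX lerXn2r ?nnegrE//.
      by rewrite (le_trans _ (lerD (UM w) (UM w)))// addr_ge0.
    by rewrite (le_trans (ler_normB _ _))// lerD.
  - apply: aeW => w.
    have h : U w - u n w @[n --> \oo] --> (0 : R).
      by rewrite -(subrr (U w)); apply: cvgB; [exact: cvg_cst|exact: uU].
    rewrite /= -(mulr0 0); under eq_fun do rewrite expr2.
    exact: (cvgM h h).
rewrite Rint_cst in uU0.
have [n /= nU] : exists n, \int[P]_w ((U w - u n w) ^+ 2) <= e / 4.
  have /cvgr_norm_le := uU0.
  move=> /(_ (e / 4)); rewrite normr0 => /(_ e40) [n _ h].
  by exists n; apply: le_trans (h n (leqnn n)); exact: ler_norm.
have [_ _ /(_ _ e40)[f bf uf]] := au n.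
exists f => //.
have mf := bounded_continuous_comp bf.
have [cf [K fK]] := bf.
have I1 := L1_sqrB mU (mu n) UM (uM n).
have I2 := L1_sqrB (mu n) mf (uM n) (fun w => fK (W w)).
apply: (@le_trans _ _ (\int[P]_w (2 * (U w - u n w) ^+ 2 +
                                  2 * (u n w - f (W w)) ^+ 2))).
  apply: Rint_le; first exact: L1_sqrB mU mf UM (fun w => fK (W w)).
    by apply: L1D; exact: L1Z.
  move=> w; have := sqr_ge0 ((U w - u n w) - (u n w - f (W w))).
  by nra.
rewrite RintD; [|exact: L1Z|exact: L1Z].
rewrite !RintZ//; move: nU uf => /=; lra.
Qed.

Lemma approximable_continuous f : bounded_continuous f -> approximable (f \o W).
Proof.
move=> bf; split; first exact: bounded_continuous_comp.
  by have [_ [M fM]] := bf; exists M => w; exact: fM.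
move=> e e0; exists f => //.
under eq_Rintegral do rewrite subrr expr0n.
by rewrite Rint_cst ltW.
Qed.

(** The indicator of ]a, +oo[ is the limit of the continuous functions equal to
    n (x - a) clamped to [0, 1], and the Borel sets B whose indicator is
    approximable form a Dynkin system. *)
Lemma approximable_preimage B : measurable B -> approximable \1_(W @^-1` B).
Proof.
have E : @measurable _ R = <<s @RGenOInfty.G R >>.
  exact: RGenOInfty.measurableE.
have aT : approximable (fun=> 1).
  apply: (@approximable_continuous (fun=> 1)); split.
    by move=> x; exact: cvg_cst.
  by exists 1 => x; rewrite normr1.
rewrite E; move: B.
apply: (@dynkin_induction _ _ _ (fun B => approximable \1_(W @^-1` B)) E).
- move=> _ _ [a ->] [b ->]; exists (Order.max a b).
  by apply/seteqP; split => x /=; rewrite !in_itv/= !andbT gt_max => /andP.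
- by rewrite preimage_setT indicT.
- move=> _ [a ->].
  pose f n (x : R) := Order.min 1 (Order.max 0 (n%:R * (x - a))).
  apply: (@approximable_lim 1 (fun n => f n \o W)).
  + move=> n; apply: approximable_continuous; split.
      have -> : f n = (cst 1 \min (cst 0 \max (fun x => n%:R * (x - a)))) by [].
      apply: min_fun_continuous; first by move=> x; exact: cvg_cst.
      apply: max_fun_continuous; first by move=> x; exact: cvg_cst.
      move=> x; apply: cvgM; first exact: cvg_cst.
      by apply: cvgB; [exact: cvg_id|exact: cvg_cst].
    exists 1 => x; rewrite /f ger0_norm ?ge_min ?lexx//.
    by rewrite le_min ler01 le_max lexx.
  + move=> n w; rewrite /f ger0_norm ?ge_min ?lexx//.
    by rewrite le_min ler01 le_max lexx.
  + move=> w; rewrite indicE; have [aW|aW] := ltP a (W w).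
      rewrite mem_set/= ?in_itv/= ?aW//.
      apply: cvg_near_cst.
      near=> n; rewrite /f.
      have h : 1 <= n%:R * (W w - a).
        rewrite -ler_pdivrMr ?subr_gt0//.
        near: n; exact: nbhs_infty_ger.
      by rewrite max_r ?min_l// (le_trans _ h).
    rewrite memNset/= ?in_itv/= ?andbT; last by apply/negP; rewrite -leNgt.
    apply: cvg_near_cst; apply: nearW => n; rewrite /f.
    rewrite max_l ?min_r//.
    by rewrite mulr_ge0_le0// subr_le0.
- move=> B _ aB.
  have := approximable_lin (-1) aB aT.
  congr approximable; apply/funext => w; rewrite !indicE preimage_setC in_setC.
  by case: (_ \in _); rewrite /= ?mulr1 ?mulr0 ?add0r// addNr.
- move=> F mF tF aF.
  pose G n := \bigcup_(k < n) F k.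
  apply: (@approximable_lim 1 (fun n => \1_(W @^-1` G n))).
  + elim=> [|n IH].
      have := approximable_lin (-1) aT aT.
      congr approximable; apply/funext => w.
      rewrite /G bigcup_mkord big_ord0 preimage_set0 indic0.
      by rewrite mulr1 addNr.
    have := approximable_lin 1 IH (aF n).
    congr approximable; apply/funext => w.
    rewrite mul1r /G !bigcup_mkord big_ord_recr/= preimage_setU !indicE in_setU.
    have [Fn|Fn] := boolP (w \in W @^-1` F n); last by rewrite orbF addr0.
    rewrite orbT.
    have -> : (w \in W @^-1` (\big[setU/set0]_(i < n) F i)) = false.
      apply/negbTE/negP; rewrite !inE -bigcup_mkord => -[k /= kn Fk].
      move: Fn; rewrite inE => Fn.
      have := tF k n Logic.I Logic.I (ex_intro _ (W w) (conj Fk Fn)).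
      by move=> kn'; rewrite kn' ltnn in kn.
    by rewrite add0r.
  + by move=> n w; rewrite indicE; case: (_ \in _); rewrite ?normr1 ?normr0.
  + move=> w; rewrite indicE.
    have [|nF] := boolP (w \in _).
      rewrite inE => -[k _ Fk].
      apply: cvg_near_cst; exists k.+1 => // n /= kn.
      by rewrite indicE mem_set//; exists k.
    apply: cvg_near_cst; apply: nearW => n.
    rewrite indicE memNset// => -[k _ Fk].
    by move: nF => /negP; apply; rewrite inE; exists k.
Unshelve. all: by end_near. Qed.

(** Density of the bounded continuous functions of W among the bounded
    functions that are measurable with respect to W. *)
Lemma approximable_bounded (M : R) (U : T -> R) :
  measurable_fun [set: g_sigma_algebra_preimageType W] U ->
  (forall w, `|U w| <= M) -> approximable U.
Proof.
move: M U.
apply: (@bounded_measurable_ind _ (g_sigma_algebra_preimageType W) R).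
- by move=> _ [B mB <-]; rewrite setTI; exact: approximable_preimage.
- exact: approximable_lin.
- exact: approximable_lim.
Qed.

End density.

(** * The variational formula for the variance of E[X | W] *)

Section variational.
Context {d} {T : measurableType d} {R : realType} (P : probability T R).
Variables (X W : T -> R).
Hypotheses (mX : measurable_fun [set: T] X) (mW : measurable_fun [set: T] W).
Hypotheses (IX2 : L1 P (fun w => X w ^+ 2)) (EX : (\int[P]_w (X w)%:E = 0)%E).

Let IX : L1 P X := L1_sqr mX IX2.
Let Z := cond_exp P X W.

(** Up to the constant E [X^2], the opposite of the mean squared error of the
    estimator f(W) of X. *)
Definition gain (f : R -> R) : R :=
  \int[P]_w (2 * (X w * f (W w)) - f (W w) ^+ 2).

Let ZP : is_cond_exp P X W Z.
Proof.
pose W' : {mfun T >-> R} := mfun_Sub (mem_set mW).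
exact: xgetPex (cond_exp_exists W' IX).
Qed.

Let IZ : L1 P Z. Proof. by case: ZP. Qed.
Let mZ : measurable_fun [set: T] Z. Proof. exact: L1_measurable IZ. Qed.

Let varZ : 'V_P[Z]%E = (\int[P]_w (Z w ^+ 2)%:E)%E.
Proof.
have EZ : (\int[P]_w (Z w)%:E = 0)%E.
  have [_ _ ->//] := ZP.
  by exists setT => //; rewrite preimage_setT setIT.
rewrite /variance [in LHS]unlock unlock EZ/=; apply: eq_integral => w _ /=.
by rewrite /GRing.mul/= subr0 -expr2.
Qed.

Lemma gain_L1 f : bounded_continuous f ->
  L1 P (fun w => 2 * (X w * f (W w)) - f (W w) ^+ 2).
Proof.
move=> bf; have [cf [M fM]] := bf.
have mf := bounded_continuous_comp mW bf.
have fWM w : `|f (W w)| <= M by exact: fM.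
apply: L1B; first by apply: L1Z; exact: (L1_mulbounded IX mf fWM).
exact: (L1_bounded_sqr P mf fWM).
Qed.

(** Here X may be replaced by Z = E[X | W], and 2 Z f(W) - f(W)^2 <= Z^2
    pointwise. *)
Lemma gain_le_var f : bounded_continuous f -> ((gain f)%:E <= 'V_P[Z])%E.
Proof.
move=> bf; have [cf [M fM]] := bf.
have [Z2oo|] := ltP (\int[P]_w (Z w ^+ 2)%:E)%E +oo%E; last first.
  by rewrite varZ leye_eq => /eqP ->; exact: leey.
have IZ2 := L1_sqrP mZ Z2oo.
have mf := bounded_continuous_comp mW bf.
have fWM w : `|f (W w)| <= M by exact: fM.
have If2 : L1 P (fun w => f (W w) ^+ 2).
  exact: (L1_bounded_sqr P mf fWM).
rewrite varZ -RintegralE// lee_fin /gain.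
have IXf := L1_mulbounded IX mf fWM.
have IZf := L1_mulbounded IZ mf fWM.
rewrite RintB//; last exact: L1Z.
rewrite RintZ// -(cond_exp_mul mW IX ZP _ fWM); last first.
  move=> _ B mB; exists (f @^-1` B) => //.
  rewrite -[_ @^-1` _]setTI.
  exact: continuous_measurable_fun.
rewrite -RintZ// -RintB//; last exact: L1Z.
apply: Rint_le => //; first by apply: L1B => //; exact: L1Z.
by move=> w; have := sqr_ge0 (Z w - f (W w)); nra.
Qed.

(** The bound extends by density from the functions f(W) to any bounded
    function U measurable with respect to W.  Take for U the truncation of
    Z = E[X | W] to [- n, n]: since E [X U] = E [Z U] >= E [U^2], the gain of U
    is at least E [U^2], which tends to E [Z^2] as n grows. *)
Lemma var_le_gain (c : R) :
  (forall f, bounded_continuous f -> gain f <= c) -> ('V_P[Z] <= c%:E)%E.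
Proof.
move=> gc; rewrite varZ.
pose U (n : nat) w := Order.max (- n%:R) (Order.min n%:R (Z w)).
have UM n w : `|U n w| <= n%:R.
  rewrite /U ler_norml le_max lexx/= ge_max ge_min lexx/= andbT.
  by rewrite (@le_trans _ _ 0)// oppr_le0.
have mUW n : measurable_fun [set: g_sigma_algebra_preimageType W] (U n).
  have [mZW _ _] := ZP.
  by apply: measurable_maxr => //; exact: measurable_minr.
have mU n : measurable_fun [set: T] (U n).
  exact: (preimage_measurable_fun mW (mUW n)).
have IU2 n : L1 P (fun w => U n w ^+ 2).
  exact: (L1_bounded_sqr P (mU n) (UM n)).
have IXU n := L1_mulbounded IX (mU n) (UM n).
have IZU n := L1_mulbounded IZ (mU n) (UM n).
have Uc n : 2 * \int[P]_w (X w * U n w) - \int[P]_w (U n w ^+ 2) <= c.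
  rewrite -RintZ// -RintB//; last exact: L1Z.
  have IXUd : L1 P (fun w => (X w - U n w) ^+ 2).
    have := L1D (L1B IX2 (L1Z 2 (IXU n))) (IU2 n).
    by apply: L1_eq => w; ring.
  (* The gains of U and f differ by 2 (X - U) (U - f) + (U - f)^2 in mean.
     Young's inequality bounds the cross term by
     de (X - U)^2 + (U - f)^2 / de; the weight de and then the tolerance on
     E [(U - f)^2] are chosen so that the total error is e. *)
  pose K := \int[P]_w (X w - U n w) ^+ 2.
  apply/ler_addgt0Pr => e e0.
  have K1 : 0 < K + 1.
    by rewrite ltr_wpDl//; apply: Rintegral_ge0 => w _; exact: sqr_ge0.
  pose de := e / (K + 1).
  have de0 : 0 < de by exact: divr_gt0.
  have de1 : 0 < 1 + de^-1 by rewrite addr_gt0// invr_gt0.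
  have [_ _ /(_ (de / (1 + de^-1)) (divr_gt0 de0 de1))[f bf]] :=
    approximable_bounded P mW (mUW n) (UM n).
  have [cf [M fM]] := bf.
  have mf := bounded_continuous_comp mW bf.
  have fWM w : `|f (W w)| <= M by exact: fM.
  have If2 : L1 P (fun w => f (W w) ^+ 2).
    exact: (L1_bounded_sqr P mf fWM).
  have IXf := L1_mulbounded IX mf fWM.
  have IUf := L1_sqrB P (mU n) mf (UM n) fWM.
  have := gc f bf; rewrite /gain => gf.
  rewrite ler_pdivlMr// => Uf.
  apply: (@le_trans _ _ (\int[P]_w ((2 * (X w * f (W w)) - f (W w) ^+ 2) +
      (de * (X w - U n w) ^+ 2 + (1 + de^-1) * (U n w - f (W w)) ^+ 2)))).
    apply: Rint_le.
    - by apply: L1B => //; exact: L1Z.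
    - apply: L1D; first by apply: L1B => //; exact: L1Z.
      by apply: L1D; exact: L1Z.
    - move=> w.
      have : 0 <= de * ((X w - U n w) - de^-1 * (U n w - f (W w))) ^+ 2.
        by rewrite mulr_ge0 ?sqr_ge0// ltW.
      have -> : de * (X w - U n w - de^-1 * (U n w - f (W w))) ^+ 2 =
        de * (X w - U n w) ^+ 2 - 2 * ((X w - U n w) * (U n w - f (W w))) +
        de^-1 * (U n w - f (W w)) ^+ 2.
        by field; rewrite gt_eqF.
      by lra.
  rewrite RintD; [|by apply: L1B => //; exact: L1Z|by apply: L1D; exact: L1Z].
  rewrite [X in _ + X]RintD; [|exact: L1Z|exact: L1Z].
  rewrite [X in _ + (X + _)]RintZ// [X in _ + (_ + X)]RintZ// -/K.
  have dK : de * (K + 1) = e by rewrite /de divfK// gt_eqF.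
  by lra.
apply: (@fatou_le _ _ _ _ (fun n w => U n w ^+ 2)).
- by move=> n; exact: measurable_funX.
- exact: measurable_funX.
- by move=> n w; exact: sqr_ge0.
- by move=> w; exact: sqr_ge0.
- apply: aeW => w; apply: cvg_near_cst; near=> n.
  have : `|Z w| <= n%:R by near: n; exact: nbhs_infty_ger.
  rewrite ler_norml => /andP[h1 h2].
  by rewrite /U min_r// max_r.
- move=> n; rewrite -RintegralE// lee_fin; apply: le_trans (Uc n).
  rewrite -(cond_exp_mul mW IX ZP (mUW n) (UM n)).
  suff : \int[P]_w (U n w ^+ 2) <= \int[P]_w (Z w * U n w) by lra.
  apply: Rint_le => // w; rewrite /U.
  move: (Z w) (ler0n R n) => z; set m := n%:R => m0.
  case: (leP m z) => mz; first by rewrite max_r; [nra|lra].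
  by case: (leP (- m) z) => zm; nra.
Unshelve. all: by end_near. Qed.

End variational.

(** * Quantile functions *)

Section uniform.
Context {R : realType}.

Definition uniform01 : probability (measurableTypeR R) R :=
  uniform_prob (@ltr01 R).

Lemma uniform01E (A : set R) : measurable A ->
  uniform01 A = lebesgue_measure (A `&` `]0, 1[%classic).
Proof.
move=> mA; transitivity (\int[@lebesgue_measure R]_(x in A)
    (uniform_pdf 0 1 x)%:E)%E; first by [].
rewrite integral_uniform_pdf.
rewrite (eq_integral (fun=> 1%E)); last first.
  move=> x; rewrite inE => -[_ /=]; rewrite in_itv/= => x01.
  by rewrite /uniform_pdf x01 subr0 invr1.
rewrite integral_cst//=; last exact: measurableI.
rewrite mul1e; apply/eqP; rewrite eq_le; apply/andP; split.
  apply: (@le_trans _ _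
    (lebesgue_measure ((A `&` `]0, 1[) `|` [set (0 : R); 1]))).
    apply: le_measure; rewrite ?inE.
    - exact: measurableI.
    - by apply: measurableU; [exact: measurableI|exact: measurableU].
    - move=> x [Ax /=]; rewrite in_itv/= => /andP[].
      rewrite !le_eqVlt => /predU1P[<- _|x0]; first by right; left.
      move=> /predU1P[->|x1]; first by right; right.
      by left; split; rewrite //= in_itv/= x0.
  apply: (le_trans (measureU2 _ _ _)) => //.
  + exact: measurableI.
  + exact: measurableU.
  + rewrite [X in (_ + X <= _)%E](_ : _ = 0%E) ?adde0//.
    apply: countable_lebesgue_measure0.
    by apply: finite_set_countable; exact: finite_set2.
apply: le_measure; rewrite ?inE.
- exact: measurableI.
- exact: measurableI.
- by apply: setIS; apply: subset_itv; rewrite bnd_simp.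
Qed.

(** The endpoints 0 and 1, where a quantile function may be infinite, form a
    null set. *)
Lemma ae_uniform01 (p : R -> Prop) :
  (forall x, 0 < x < 1 -> p x) -> {ae uniform01, forall x, p x}.
Proof.
move=> p01; exists (~` `]0, 1[%classic); split.
- exact: measurableC.
- by rewrite uniform01E ?setICl ?measure0//; exact: measurableC.
- move=> x /= px; apply: contra_not px => x01; apply: p01.
  by move: x01; rewrite in_itv.
Qed.

End uniform.

Section quantile.
Context {d} {T : measurableType d} {R : realType} {P : probability T R}.
Variable X : {RV P >-> R}.

Let F r := fine (cdf X r).
Let FE r : cdf X r = (F r)%:E.
Proof. by rewrite /F fineK// fin_num_measure. Qed.
Let F0 r : 0 <= F r. Proof. by rewrite fine_ge0. Qed.
Let F1 r : F r <= 1. Proof. by rewrite -lee_fin -FE cdf_le1. Qed.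
Let F_nd r s : r <= s -> F r <= F s.
Proof. by move=> rs; rewrite -lee_fin -!FE cdf_nondecreasing. Qed.
Let F_rc r : F x @[x --> r^'+] --> F r.
Proof.
by apply: fine_cvg; rewrite -FE; exact: cdf_right_continuous.
Qed.
Let F_y : F x @[x --> +oo] --> (1 : R).
Proof. by apply: fine_cvg; exact: cvg_cdfy1. Qed.
Let F_Ny : F x @[x --> -oo] --> (0 : R).
Proof. by apply: fine_cvg; exact: cvg_cdfNy0. Qed.

(** The generalized inverse of the distribution function. *)
Definition quantile (u : R) : R :=
  if 0 < u < 1 then inf [set x | u <= F x] else 0.

Lemma quantile_has_inf (u : R) : 0 < u < 1 -> has_inf [set x | u <= F x].
Proof.
move=> /andP[u0 u1]; split.
  have [x [xr ux]] : \forall x \near +oo, u <= F x.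
    near=> x; apply: ltW; near: x.
    by apply: (cvgr_gt 1 F_y).
  exists (x + 1); apply: ux.
  by rewrite ltrDl.
have [x [xr ux]] : \forall x \near -oo, F x < u.
  by apply: (cvgr_lt 0 F_Ny).
exists (x - 1) => y /= uy; rewrite leNgt; apply/negP => yx.
have : F (x - 1) < u by apply: ux; rewrite ltrBlDr ltrDl.
by rewrite ltNge => /negP; apply; apply: le_trans uy _; exact/F_nd/ltW.
Unshelve. all: by end_near. Qed.

(** The Galois connection between a distribution function and its generalized
    inverse.  Right continuity of F makes the infimum a minimum. *)
Lemma quantile_le (u x : R) : 0 < u < 1 -> (quantile u <= x) = (u <= F x).
Proof.
move=> u01; have hi := quantile_has_inf u01.
rewrite /quantile u01; apply/idP/idP => [qx|ux]; last first.
  by apply: ge_inf; [case: hi|].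
apply: cvgr_to_ge (@F_rc x) _.
near=> y.
have xy : x < y by near: y; exact: nbhs_right_gt.
have [s /= us sy] := inf_lt hi.1 (le_lt_trans qx xy).
by apply: le_trans us _; exact/F_nd/ltW.
Unshelve. all: by end_near. Qed.

Lemma quantile_nd (u v : R) : 0 < u -> u <= v -> v < 1 ->
  quantile u <= quantile v.
Proof.
move=> u0 uv v1; have v0 := lt_le_trans u0 uv.
rewrite quantile_le ?u0 ?(le_lt_trans uv)//.
by apply: (le_trans uv); rewrite -quantile_le ?lexx// v1 v0.
Qed.

Let preimage_quantile (x : R) : quantile @^-1` `]x, +oo[ =
  (`]F x, 1[ `|` (~` `]0, 1[ `&` [set _ | x < 0]))%classic.
Proof.
apply/seteqP; split => u /=; rewrite !in_itv/= !andbT.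
  case/boolP: (0 < u < 1) => u01.
    by rewrite ltNge quantile_le// -ltNge => ->; left; case/andP: u01.
  by rewrite /quantile (negbTE u01); right.
case=> [/andP[Fu u1]|[/negP u01 x0]].
  rewrite ltNge quantile_le -?ltNge// u1 andbT.
  exact: le_lt_trans Fu.
by rewrite /quantile (negbTE u01).
Qed.

Lemma measurable_quantile :
  @measurable_fun _ _ (measurableTypeR R) R setT quantile.
Proof.
apply: (measurability (@RGenOInfty.G R)); first exact: RGenOInfty.measurableE.
move=> _ [_ [x ->] <-]; rewrite setTI preimage_quantile.
apply: measurableU => //; apply: measurableI; first exact: measurableC.
have [x0|x0] := ltP x 0.
  by rewrite (_ : [set _ | _] = setT)//; apply/seteqP; split.
by rewrite (_ : [set _ | _] = set0)//; apply/seteqP; split => // y /=.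
Qed.

(** Inverse transform sampling: the quantile function of X applied to a uniform
    variable has the law of X.  Both laws agree on the rays ]x, +oo[, which
    form a generating set stable under intersection. *)
Lemma distribution_quantile (A : set R) : measurable A ->
  uniform01 (quantile @^-1` A) = P (X @^-1` A).
Proof.
pose q : {mfun measurableTypeR R >-> R} :=
  @mfun_Sub _ _ (measurableTypeR R) R quantile (mem_set measurable_quantile).
move=> mA.
have -> : uniform01 (quantile @^-1` A) = distribution uniform01 q A by [].
have -> : P (X @^-1` A) = distribution P X A by [].
apply: (measure_unique (@RGenOInfty.G R) (fun n => `]- n%:R, +oo[%classic)).
- exact: RGenOInfty.measurableE.
- move=> _ _ [a ->] [b ->]; exists (Order.max a b).
  by apply/seteqP; split => x /=; rewrite !in_itv/= !andbT gt_max => /andP.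
- by move=> n; exists (- n%:R).
- apply/seteqP; split => // x _; exists (Num.bound `|x|) => //=.
  rewrite in_itv/= andbT ltrNl (le_lt_trans (ler_norm _))// normrN.
  by rewrite archi_boundP.
- move=> _ [x ->].
  transitivity (1 - F x)%:E; last by rewrite -[RHS]/(ccdf X x) ccdf_1_cdf FE.
  transitivity (uniform01 (quantile @^-1` `]x, +oo[)); first by [].
  rewrite uniform01E; last first.
    by rewrite -[_ @^-1` _]setTI; exact: measurable_quantile.
  rewrite preimage_quantile.
  rewrite (_ : _ `&` _ = `]F x, 1[%classic); last first.
    apply/seteqP; split => y /=; rewrite !in_itv/=.
      by move=> [[//|[y01 _]] /y01].
    move=> /andP[Fy y1]; rewrite Fy y1 (le_lt_trans _ Fy)//.
    by split => //; left.
  rewrite lebesgue_measure_itv/= lte_fin.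
  have [|F1'] := ltP (F x) 1; first by [].
  by rewrite (_ : F x = 1) ?subrr//; apply/eqP; rewrite eq_le F1.
- by move=> n; rewrite (le_lt_trans (probability_le1 _ _))// ltry.
- by [].
Qed.

End quantile.

(** * Helly selection *)

(** Bolzano-Weierstrass is applied to each row along the subsequence obtained
    for the rows before it.  The diagonal subsequence phi is, from the index
    i + 1 on, made of later and later terms of the subsequence built for
    row i. *)
Lemma diagonal_cvg (R : realType) (a : nat -> nat -> R) :
  (forall i, exists C, forall n, `|a i n| <= C) ->
  exists2 phi : nat -> nat, (forall n, (n <= phi n)%N) &
    forall i, cvgn (a i \o phi).
Proof.
move=> aC.
have /choice[g gP] (p : nat * (nat -> nat)) : exists g : nat -> nat,
    (forall n, (n <= g n)%N) /\ cvgn (a p.1 \o p.2 \o g).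
  case: p => i psi /=.
  have [C aiC] := aC i.
  have [|g ig cg] := @bolzano_weierstrass R (a i \o psi).
    exists C; split; first exact: num_real.
    by move=> x Cx n _ /=; rewrite (le_trans (aiC _))// ltW.
  exists g; split => //; elim=> // n IH.
  rewrite (leq_ltn_trans IH)//.
  by rewrite ltnNge -leEnat ig ltnn.
(* psi k is the composite of the first k extractions. *)
pose psi := fix psi k := if k is k'.+1 then psi k' \o g (k', psi k') else id.
have psiD i n : exists h : nat -> nat, (forall m, (m <= h m)%N) /\
    psi (n + i)%N = psi i \o h.
  elim: n => [|n [h [hm E]]]; first by exists id.
  exists (h \o g ((n + i)%N, psi (n + i)%N)); split => [m|].
    by apply: leq_trans (hm _); have [] := gP ((n + i)%N, psi (n + i)%N).
  by rewrite addSn /= {1}E.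
exists (fun n => psi n n) => [n|i].
  have [h [hm E]] := psiD 0 n; rewrite addn0 in E.
  by rewrite E.
have /cvg_ex[/= l al] : cvgn (a i \o psi i.+1) := (gP (i, psi i)).2.
apply/cvg_ex; exists l; apply/cvgrPdist_le => /= e e0.
move/cvgrPdist_le : al => /(_ e e0)[N _ aN].
exists (maxn N i.+1) => // n /=; rewrite geq_max => /andP[Nn ni].
have [h [hm]] := psiD i.+1 (n - i.+1)%N; rewrite subnK// => ->.
by apply: aN => /=; exact: leq_trans Nn (hm n).
Qed.

Section helly.
Context (R : realType).
Local Notation rt := (@ratr R).

(** A diagonal extraction makes q (phi n) x converge to l x at every rational x
    of ]0, 1[, and by monotonicity the convergence extends to every u at which
    l has no jump.  Each jump contains a rational number, and distinct jumps
    are disjoint, so that the exceptional points form a countable, hence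
    negligible, set. *)
Lemma helly_selection (q : nat -> R -> R) :
  (forall n, @measurable_fun _ _ (measurableTypeR R) R setT (q n)) ->
  (forall n u v, 0 < u -> u <= v -> v < 1 -> q n u <= q n v) ->
  (forall u, 0 < u < 1 -> exists C, forall n, `|q n u| <= C) ->
  exists (phi : nat -> nat) (Q : R -> R), [/\ forall n, (n <= phi n)%N,
    @measurable_fun _ _ (measurableTypeR R) R setT Q &
    {ae @uniform01 R, forall u, q (phi n) u @[n --> \oo] --> Q u}].
Proof.
move=> mq ndq bq.
pose r (k : nat) : R := rt (odflt 0%Q (unpickle k)).
have [phi phin cphi] : exists2 phi : nat -> nat, (forall n, (n <= phi n)%N) &
    forall i, cvgn ((fun n => if 0 < r i < 1 then q n (r i) else 0) \o phi).
  apply: (@diagonal_cvg R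
    (fun i n => if 0 < r i < 1 then q n (r i) else 0)) => i.
  have [r01|_] := boolP (0 < r i < 1); first exact: bq.
  by exists 0 => n; rewrite normr0.
pose l (x : R) := limn (fun n => q (phi n) x).
have ql (x : rat) : 0 < rt x < 1 ->
    q (phi n) (rt x) @[n --> \oo] --> l (rt x).
  move=> x01; have := cphi (pickle x); rewrite /r pickleK /= x01.
  exact.
have l_nd (x y : rat) : 0 < rt x -> x <= y -> rt y < 1 ->
    l (rt x) <= l (rt y).
  move=> x0 xy y1.
  have xyR : rt x <= rt y by rewrite ler_rat.
  apply: ler_cvg_to (ql x _) (ql y _) _.
  - by rewrite x0 (le_lt_trans xyR).
  - by rewrite (lt_le_trans x0 xyR).
  - by apply: nearW => n; exact: ndq.
(* u is good when l has no jump at u, and bad otherwise. *)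
pose good (u : R) := forall e : R, 0 < e -> exists x y : rat,
  [/\ 0 < rt x, rt x < u, u < rt y, rt y < 1 &
      l (rt y) - l (rt x) <= e].
pose bad := [set u : R | 0 < u < 1 /\ ~ good u].
have cbad : countable bad.
  (* c u is a rational number inside the jump of l at u. *)
  have /choice[c cP] (u : R) : exists c : rat, bad u ->
      forall x y : rat, 0 < rt x -> rt x < u -> u < rt y ->
        rt y < 1 -> l (rt x) < rt c /\ rt c < l (rt y).
    have [[/andP[u0 u1] /existsNP[e]]|] := pselect (bad u); last by exists 0.
    move=> /not_implyP[e0 xy].
    pose A := [set l (rt x) | x in [set x : rat | 0 < rt x /\ rt x < u]].
    have xyl x y : 0 < rt x -> rt x < u -> u < rt y ->
        rt y < 1 -> l (rt x) + e < l (rt y).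
      move=> x0 xu uy y1; rewrite ltNge; apply/negP => h; apply: xy.
      by exists x, y; split => //; rewrite lerBlDl.
    have A0 : A !=set0.
      have [x] := rat_in_itvoo u0; rewrite in_itv/= => /andP[x0 xu].
      by exists (l (rt x)); exists x.
    have Aub y : u < rt y -> rt y < 1 -> ubound A (l (rt y) - e).
      move=> uy y1 _ [x [x0 xu] <-]; rewrite lerBrDr; apply: ltW.
      exact: xyl.
    have [y1] := rat_in_itvoo u1; rewrite in_itv/= => /andP[uy1 y11].
    have [c] := @rat_in_itvoo R (sup A) (sup A + e) ltac:(by rewrite ltrDl).
    rewrite in_itv/= => /andP[Ac cA].
    exists c => _ x y x0 xu uy yy1; split.
      apply: le_lt_trans Ac; apply: ub_le_sup; last by exists x.
      by exists (l (rt y1) - e); exact: Aub.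
    apply: lt_le_trans cA _; rewrite -lerBrDr.
    by apply: ge_sup => //; exact: Aub.
  apply/countable_injP; exists (pickle \o c) => u v; rewrite !inE => bu bv /=.
  move=> /(pcan_inj pickleK) cuv.
  (* For a < t < b with t rational, c a < l t < c b. *)
  suff H (a b : R) : bad a -> bad b -> c a = c b -> ~ a < b.
    by apply/eqP; rewrite eq_le !leNgt; apply/andP; split; apply/negP; exact: H.
  move=> {bu bv cuv u v} ba bb cab ab.
  have [t] := rat_in_itvoo ab; rewrite in_itv/= => /andP[at_ tb].
  have [[/andP[a0 a1] _] [/andP[b0 b1] _]] := (ba, bb).
  have [x] := rat_in_itvoo a0; rewrite in_itv/= => /andP[x0 xa].
  have [y] := rat_in_itvoo b1; rewrite in_itv/= => /andP[yb y1].
  have [_ h1] := cP a ba x t x0 xa at_ (lt_trans tb b1).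
  have [h2 _] := cP b bb t y (lt_trans a0 at_) tb yb y1.
  by have := lt_trans h1 h2; rewrite cab ltxx.
have conv u : 0 < u < 1 -> good u -> cvgn (fun n => q (phi n) u).
  move=> /andP[u0 u1] gu.
  pose A := [set l (rt x) | x in [set x : rat | 0 < rt x /\ rt x < u]].
  have lsup (x : rat) : 0 < rt x -> rt x < u -> l (rt x) <= sup A.
    move=> x0 xu; have [y] := rat_in_itvoo u1; rewrite in_itv/= => /andP[uy y1].
    apply: ub_le_sup; last by exists x.
    exists (l (rt y)) => _ [z [z0 zu] <-]; apply: l_nd => //.
    by rewrite -(ler_rat R) ltW// (lt_trans zu).
  have suple (y : rat) : u < rt y -> rt y < 1 -> sup A <= l (rt y).
    move=> uy y1; apply: ge_sup.
      have [x] := rat_in_itvoo u0; rewrite in_itv/= => /andP[x0 xu].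
      by exists (l (rt x)); exists x.
    move=> _ [z [z0 zu] <-]; apply: l_nd => //.
    by rewrite -(ler_rat R) ltW// (lt_trans zu).
  apply/cvg_ex; exists (sup A); apply/cvgrPdist_le => /= e e0.
  have e20 : 0 < e / 2 by rewrite divr_gt0.
  have [x [y [x0 xu uy y1 xy]]] := gu _ e20.
  have x01 : 0 < rt x < 1 by rewrite x0 (lt_trans xu).
  have y01 : 0 < rt y < 1 by rewrite y1 (lt_trans u0).
  have h1 := lsup x x0 xu; have h2 := suple y uy y1.
  have qx := (cvgrPdist_le _ _).1 (ql x x01) _ e20.
  have qy := (cvgrPdist_le _ _).1 (ql y y01) _ e20.
  near=> n.
  have : `|l (rt x) - q (phi n) (rt x)| <= e / 2 by near: n; exact: qx.
  have : `|l (rt y) - q (phi n) (rt y)| <= e / 2 by near: n; exact: qy.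
  have := ndq (phi n) _ _ x0 (ltW xu) u1.
  have := ndq (phi n) _ _ u0 (ltW uy) y1.
  rewrite !ler_norml => ? ? /andP[? ?] /andP[? ?]; apply/andP; split; lra.
(* The upper limit is measurable, and it is the limit wherever the
   sequence converges. *)
exists phi, (fun u => fine (limn_esup (fun n => (q (phi n) u)%:E))).
split => //.
  apply: measurableT_comp => //.
  apply: measurable_fun_limn_esup => n.
  by apply: measurableT_comp => //; exact: mq.
have mbad : measurable (bad : set R) by exact: countable_measurable.
have aebad : {ae @uniform01 R, forall u, ~ bad u}.
  exists bad; split => //; last by move=> u /= /contrapT.
  rewrite uniform01E//; apply: countable_lebesgue_measure0.
  by apply: sub_countable cbad; exact: subset_card_le.
have ae01 : {ae @uniform01 R, forall u, 0 < u < 1} by exact: ae_uniform01.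
have FF : Filter (almost_everywhere (@uniform01 R)).
  exact: ae_filter_ringOfSetsType.
apply: (@filterS2 _ _ FF _ _ _ _ aebad ae01) => u nbad u01.
have gu : good u.
  by apply: contrapT => gu; apply: nbad; split.
have /cvg_ex[L qL] := conv u u01 gu.
have /cvg_limn_einf_sup[_ ->] : (q (phi n) u)%:E @[n --> \oo] --> L%:E.
  by apply: cvg_EFin qL; exact: nearW.
exact: qL.
Unshelve. all: by end_near. Qed.

End helly.

(** * Joint laws and noises of the form Q(U) *)

Section same_law.
Context {d1 d2 d'} {T1 : measurableType d1} {T2 : measurableType d2}
  {T' : measurableType d'} {R : realType}
  (P1 : probability T1 R) (P2 : probability T2 R).
Variables (Y1 : {mfun T1 >-> T'}) (Y2 : {mfun T2 >-> T'}).
Hypothesis Y12 : forall A, measurable A -> P1 (Y1 @^-1` A) = P2 (Y2 @^-1` A).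

Lemma ge0_integral_same_law (h : T' -> \bar R) :
  measurable_fun [set: T'] h -> (forall y, 0 <= h y)%E ->
  (\int[P1]_w h (Y1 w) = \int[P2]_w h (Y2 w))%E.
Proof.
move=> mh h0; rewrite -[LHS](ge0_integral_distribution Y1 mh h0).
rewrite -[RHS](ge0_integral_distribution Y2 mh h0).
by apply: eq_measure_integral => A mA _; exact: Y12.
Qed.

Lemma integrable_same_law (h : T' -> \bar R) :
  measurable_fun [set: T'] h -> P1.-integrable [set: T1] (h \o Y1) ->
  P2.-integrable [set: T2] (h \o Y2).
Proof.
move=> mh /integrableP[_ foo]; apply/integrableP; split.
  exact: measurableT_comp.
rewrite -(@ge0_integral_same_law (abse \o h)) => [//||y].
  exact: measurableT_comp.
exact: abse_ge0.
Qed.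

Lemma integral_same_law (h : T' -> \bar R) :
  measurable_fun [set: T'] h -> P1.-integrable [set: T1] (h \o Y1) ->
  (\int[P1]_w h (Y1 w) = \int[P2]_w h (Y2 w))%E.
Proof.
move=> mh Ih; have Ih2 := integrable_same_law mh Ih.
rewrite -[LHS](integral_distribution mh Ih).
rewrite -[RHS](integral_distribution mh Ih2).
by apply: eq_measure_integral => A mA _; exact: Y12.
Qed.

End same_law.

Section joint_law.
Context {d1 d2} {T1 : measurableType d1} {T2 : measurableType d2}
  {R : realType} (P1 : probability T1 R) (P2 : probability T2 R).
Variables (X1 Y1 : {mfun T1 >-> R}) (X2 Y2 : {mfun T2 >-> R}).
Hypothesis I1 : independent_rvs P1 X1 Y1.
Hypothesis I2 : independent_rvs P2 X2 Y2.
Hypothesis X12 : forall A, measurable A -> P1 (X1 @^-1` A) = P2 (X2 @^-1` A).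
Hypothesis Y12 : forall A, measurable A -> P1 (Y1 @^-1` A) = P2 (Y2 @^-1` A).

Definition pair_rv d (T : measurableType d) (X Y : {mfun T >-> R}) w : R * R :=
  (X w, Y w).
HB.instance Definition _ d (T : measurableType d) (X Y : {mfun T >-> R}) :=
  isMeasurableFun.Build _ _ T _ (pair_rv X Y)
    (measurable_fun_pair (measurable_funPT X) (measurable_funPT Y)).

(** The joint law of an independent pair is the product of its marginals, by
    uniqueness of product measures; it is thus determined by the two
    marginals, whatever the underlying probability space. *)
Lemma joint_law_eq (A : set (R * R)) : measurable A ->
  P1 (pair_rv X1 Y1 @^-1` A) = P2 (pair_rv X2 Y2 @^-1` A).
Proof.
move=> mA.
have E d (T : measurableType d) (P : probability T R) (X Y : {mfun T >-> R}) :
  independent_rvs P X Y ->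
  ((distribution P X \x distribution P Y)%E A = P (pair_rv X Y @^-1` A)).
  move=> XY; have := @product_measure_unique _ _ _ _ _ (distribution P X)
    (distribution P Y) (distribution P (pair_rv X Y)).
  by apply => // B C mB mC; exact: XY.
rewrite -(E _ _ _ _ _ I1) -(E _ _ _ _ _ I2) /product_measure1/=.
have EY x :
    distribution P1 Y1 (xsection A x) = distribution P2 Y2 (xsection A x).
  by apply: Y12; exact: measurable_xsection.
under eq_integral do rewrite EY.
by apply: eq_measure_integral => B mB _; exact: X12.
Qed.

End joint_law.

Section product_probability.
Context {d} {T : measurableType d} {R : realType} (P : probability T R).

(** The probability space (T, P) enlarged by an independent variable uniform on
    [0, 1]. *)
Definition with_uniform : set (T * measurableTypeR R) -> \bar R :=
  (P \x @uniform01 R)%E.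

HB.instance Definition _ := Measure.on with_uniform.

Let with_uniform_setT : with_uniform setT = 1%E.
Proof.
by rewrite /with_uniform -setXTT product_measure1E//= !probability_setT mule1.
Qed.

HB.instance Definition _ :=
  Measure_isProbability.Build _ _ _ with_uniform with_uniform_setT.

Lemma with_uniform_fst A : measurable A -> with_uniform (fst @^-1` A) = P A.
Proof.
move=> mA; rewrite -setXT /with_uniform product_measure1E//=.
by rewrite probability_setT mule1.
Qed.

Lemma with_uniform_snd A : measurable A ->
  with_uniform (snd @^-1` A) = @uniform01 R A.
Proof.
move=> mA; rewrite -setTX /with_uniform product_measure1E//=.
by rewrite probability_setT mul1e.
Qed.

Definition proj_fst : {mfun (T * measurableTypeR R)%type >-> T} :=
  mfun_Sub (mem_set measurable_fst).

Definition uniform_enlargement : enlargement P :=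
  @Enlargement _ _ _ P _ _ with_uniform proj_fst with_uniform_fst.

Section of_quantile.
Variables (Q : R -> R) (mQ : @measurable_fun _ _ (measurableTypeR R) R setT Q).

Let mQsnd :
  @measurable_fun _ _ (T * measurableTypeR R)%type R setT (Q \o snd).
Proof. exact: (measurableT_comp mQ measurable_snd). Qed.

Definition comp_snd : {mfun (T * measurableTypeR R)%type >-> R} :=
  @mfun_Sub _ _ (T * measurableTypeR R)%type R _ (mem_set mQsnd).

Definition uniform_noise : noise P :=
  @Noise _ _ _ P uniform_enlargement comp_snd.

Lemma comp_sndE (A : set R) : measurable A ->
  with_uniform (comp_snd @^-1` A) = @uniform01 R (Q @^-1` A).
Proof.
move=> mA; rewrite -with_uniform_snd//.
by rewrite -[_ @^-1` _]setTI; exact: mQ.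
Qed.

Variable X : {RV P >-> R}.

Lemma independent_uniform_noise :
  independent_rvs (noise_prob uniform_noise) (@lift_rv _ _ _ P X uniform_noise)
    (noise_rv uniform_noise).
Proof.
move=> A B mA mB.
have mXA : measurable (X @^-1` A) by exact: measurable_funPTI.
have mQB : measurable (Q @^-1` B : set (measurableTypeR R)).
  by rewrite -[_ @^-1` _]setTI; exact: mQ.
transitivity (with_uniform ((X @^-1` A) `*` (Q @^-1` B))); first by [].
rewrite {1}/with_uniform product_measure1E//.
by congr (_ * _)%E; apply: esym; [exact: with_uniform_fst mXA|exact: comp_sndE].
Qed.

End of_quantile.

End product_probability.

(** * Moments under almost sure convergence *)

Section limit_moments.
Context {d} {T : measurableType d} {R : realType} (P : probability T R).

(** The bound on second moments passes to the limit by Fatou's lemma.  For the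
    mean, let cl M be the truncation to [- M, M].  As |x - cl M x| <= x^2 / M,
    replacing g by cl M g changes its mean by at most c / M, for g = f and for
    g = u n, while the means of the truncated functions converge.  Hence the
    mean of f is at most 2 c / M in absolute value, for every M. *)
Lemma moments_limit (u : nat -> T -> R) (f : T -> R) (c : R) :
  (forall n, measurable_fun [set: T] (u n)) -> measurable_fun [set: T] f ->
  (forall n, \int[P]_w (u n w)%:E = 0)%E ->
  (forall n, \int[P]_w (u n w ^+ 2)%:E <= c%:E)%E ->
  {ae P, forall w, u ^~ w @ \oo --> f w} ->
  (\int[P]_w (f w ^+ 2)%:E <= c%:E)%E /\ (\int[P]_w (f w)%:E = 0)%E.
Proof.
move=> mu mf u0 u2 uf.
have f2 : (\int[P]_w (f w ^+ 2)%:E <= c%:E)%E.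
  apply: (@fatou_le _ _ _ P (fun n w => u n w ^+ 2)) u2.
  - by move=> n; exact: measurable_funX.
  - exact: measurable_funX.
  - by move=> n w; exact: sqr_ge0.
  - by move=> w; exact: sqr_ge0.
  - apply: filterS uf => w uw.
    rewrite expr2; under eq_fun do rewrite expr2.
    exact: (cvgM uw uw).
split => //.
have c0 : 0 <= c.
  rewrite -lee_fin; apply: le_trans f2; apply: integral_ge0 => w _.
  by rewrite lee_fin sqr_ge0.
pose cl (M x : R) : R := Order.max (- M) (Order.min M x).
have clM (M x : R) : 0 < M -> `|cl M x| <= M.
  move=> M0; rewrite /cl ler_norml le_max lexx/= ge_max ge_min lexx/= andbT.
  lra.
have clx (M x : R) : 0 < M -> `|x - cl M x| <= M^-1 * x ^+ 2.
  move=> M0; rewrite /cl.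
  have [xM|xM] := leP M x.
    rewrite max_r; last by lra.
    rewrite ger0_norm ?subr_ge0// mulrC ler_pdivlMr//; nra.
  have [xM'|xM'] := leP (- M) x.
    by rewrite subrr normr0 mulr_ge0 ?sqr_ge0// invr_ge0 ltW.
  rewrite ltr0_norm ?subr_lt0// mulrC ler_pdivlMr//; nra.
have mcl (g : T -> R) (M : R) : measurable_fun [set: T] g ->
    measurable_fun [set: T] (cl M \o g).
  move=> mg; rewrite /cl/=.
  by apply: measurable_maxr => //; exact: measurable_minr.
have key (g : T -> R) (M : R) : 0 < M -> measurable_fun [set: T] g ->
    (\int[P]_w (g w ^+ 2)%:E <= c%:E)%E ->
    `|\int[P]_w g w - \int[P]_w cl M (g w)| <= c / M.
  move=> M0 mg g2.
  have Ig2 : L1 P (fun w => g w ^+ 2).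
    by apply: L1_sqrP => //; apply: le_lt_trans g2 _; rewrite ltry.
  have Ig := L1_sqr mg Ig2.
  have Icl := L1_bounded P (mcl g M mg) (fun w => clM M (g w) M0).
  rewrite -RintB//.
  apply: (le_trans (le_normr_Rintegral _ _)) => //; first exact: L1B.
  apply: (@le_trans _ _ (\int[P]_w (M^-1 * g w ^+ 2))).
    apply: Rint_le; last by move=> w; exact: clx.
      by apply: integrable_norm; exact: (L1B Ig Icl).
    exact: L1Z.
  rewrite RintZ// mulrC; apply: ler_wpM2r; first by rewrite invr_ge0 ltW.
  by rewrite -lee_fin RintegralE.
have If : L1 P f.
  apply: L1_sqr => //; apply: L1_sqrP => //.
  by apply: le_lt_trans f2 _; rewrite ltry.
suff f0 : \int[P]_w f w = 0 by rewrite -RintegralE// f0.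
have fM (M : R) : 0 < M -> `|\int[P]_w f w| <= c / M + c / M.
  move=> M0.
  have [_ clf] : L1 P (cl M \o f) /\
      \int[P]_w cl M (u n w) @[n --> \oo] --> \int[P]_w cl M (f w).
    apply: (@Rint_dominated_cvg _ _ _ P (fun n w => cl M (u n w)) (cl M \o f)
      (fun=> M)).
    - by move=> n; exact: mcl.
    - exact: mcl.
    - exact: L1_cst.
    - by move=> n w; exact: clM.
    - apply: filterS uf => w uw.
      have ccl : continuous (cl M).
        have -> : cl M = (cst (- M) \max (cst M \min id)) by [].
        apply: max_fun_continuous; first by move=> x; exact: cvg_cst.
        apply: min_fun_continuous; first by move=> x; exact: cvg_cst.
        by move=> x; exact: cvg_id.
      exact: (continuous_cvg _ (ccl (f w)) uw).
  have h1 : `|\int[P]_w cl M (f w)| <= c / M.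
    apply: cvgr_to_le (cvg_norm clf) _; apply: nearW => n.
    have := key _ M M0 (mu n) (u2 n).
    by rewrite /Rintegral u0/= sub0r normrN.
  rewrite -(subrK (\int[P]_w cl M (f w)) (\int[P]_w f w)).
  by apply: (le_trans (ler_normD _ _)); apply: lerD => //; exact: key.
apply/eqP; rewrite -normr_eq0 eq_le normr_ge0 andbT.
apply/ler_addgt0Pr => e e0; rewrite add0r.
have M0 : 0 < (c + c + 1) / e by rewrite divr_gt0//; lra.
apply: le_trans (fM _ M0) _.
rewrite invf_div -mulrDl mulrA ler_pdivrMr; last lra.
nra.
Qed.

End limit_moments.

(** Markov's inequality for a lower bound known on an event. *)
Lemma markov_on d (T : measurableType d) (R : realType) (P : probability T R)
    (g : T -> R) (A : set T) (k : R) :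
  measurable_fun [set: T] g -> measurable A -> 0 <= k ->
  (forall w, 0 <= g w) -> (forall w, A w -> k <= g w) ->
  (k%:E * P A <= \int[P]_w (g w)%:E)%E.
Proof.
move=> mg mA k0 g0 kg.
have -> : (k%:E * P A = \int[P]_w (k * \1_A w)%:E)%E.
  under eq_integral do rewrite EFinM.
  rewrite ge0_integralZl_EFin//.
    by rewrite integral_indic// setIT.
  by apply/measurable_EFinP; exact: measurable_indic.
apply: ge0_le_integral => //.
- by move=> w _; rewrite lee_fin mulr_ge0.
- apply: (measurableT_comp (@EFin_measurable R setT)).
  by apply: measurable_funM => //; exact: measurable_indic.
- by apply/measurable_EFinP.
- move=> w _; rewrite lee_fin indicE; case: (boolP (w \in A)) => Aw.
    by rewrite mulr1 kg// -in_setE.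
  by rewrite mulr0.
Qed.

Section quantile_bound.
Context {R : realType}.

(** If q u >= 0, then q^2 >= (q u)^2 on [u, 1[; if q u < 0, then q^2 >= (q u)^2
    on ]0, u].  These intervals have lengths 1 - u and u, both at least
    u (1 - u). *)
Lemma nondecreasing_pointwise_bound (q : R -> R) (c : R) :
  @measurable_fun _ _ (measurableTypeR R) R setT q ->
  (forall u v, 0 < u -> u <= v -> v < 1 -> q u <= q v) ->
  (\int[@uniform01 R]_u (q u ^+ 2)%:E <= c%:E)%E ->
  forall u, 0 < u < 1 -> q u ^+ 2 * (u * (1 - u)) <= c.
Proof.
move=> mq ndq qc u /andP[u0 u1].
have mq2 : @measurable_fun _ _ (measurableTypeR R) R setT (fun x => q x ^+ 2).
  exact: measurable_funX.
have H (A : set R) (m : R) : measurable A -> @uniform01 R A = m%:E ->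
    u * (1 - u) <= m -> (forall v, A v -> q u ^+ 2 <= q v ^+ 2) ->
    q u ^+ 2 * (u * (1 - u)) <= c.
  move=> mA Am um Aq; rewrite -lee_fin; apply: le_trans qc.
  apply: le_trans (markov_on uniform01 mq2 mA (sqr_ge0 _)
    (fun w => sqr_ge0 _) Aq).
  by rewrite [X in (_ * X)%E]Am -EFinM lee_fin ler_wpM2l// sqr_ge0.
have [qu0|qu0] := leP 0 (q u).
  apply: (H `[u, 1[%classic (1 - u)) => //.
  - rewrite uniform01E// (_ : _ `&` _ = `[u, 1[%classic); last first.
      apply/setIidl => v /=; rewrite !in_itv/= => /andP[uv ->].
      by rewrite (lt_le_trans u0).
    by rewrite lebesgue_measure_itv/= lte_fin u1.
  - by nra.
  - move=> v /=; rewrite in_itv/= => /andP[uv v1].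
    by rewrite lerXn2r ?nnegrE ?(le_trans qu0)// ndq.
apply: (H `]0, u]%classic u) => //.
- rewrite uniform01E// (_ : _ `&` _ = `]0, u]%classic); last first.
    apply/setIidl => v /=; rewrite !in_itv/= => /andP[-> vu].
    by rewrite (le_lt_trans vu).
  by rewrite lebesgue_measure_itv/= lte_fin u0 oppr0 adde0.
- by nra.
- move=> v /=; rewrite in_itv/= => /andP[v0 vu].
  have := ndq v u v0 vu u1; nra.
Qed.

End quantile_bound.


(** * Reduction to quantile functions and existence of a minimizer *)

Section gain_law.
Context {R : realType}.
Variable f : R -> R.
Hypothesis bf : bounded_continuous f.

(** The gain is an integral against the joint law of signal and noise. *)
Lemma gain_same_law d1 d2 (T1 : measurableType d1) (T2 : measurableType d2)
    (P1 : probability T1 R) (P2 : probability T2 R)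
    (X1 Y1 : {mfun T1 >-> R}) (X2 Y2 : {mfun T2 >-> R}) :
  L1 P1 (fun w => X1 w ^+ 2) ->
  independent_rvs P1 X1 Y1 -> independent_rvs P2 X2 Y2 ->
  (forall A, measurable A -> P1 (X1 @^-1` A) = P2 (X2 @^-1` A)) ->
  (forall A, measurable A -> P1 (Y1 @^-1` A) = P2 (Y2 @^-1` A)) ->
  gain P1 X1 (X1 \+ Y1) f = gain P2 X2 (X2 \+ Y2) f.
Proof.
move=> IX2 I1 I2 X12 Y12.
have mW : measurable_fun [set: T1] (X1 \+ Y1) by exact: measurable_funD.
have IG := gain_L1 (measurable_funPT X1) mW IX2 bf.
pose h (p : R * R) := (2 * (p.1 * f (p.1 + p.2)) - f (p.1 + p.2) ^+ 2)%:E.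
have mh : measurable_fun [set: R * R] h.
  have m12 : measurable_fun [set: R * R] (fun p : R * R => f (p.1 + p.2)).
    apply: measurableT_comp.
      by apply: continuous_measurable_fun; case: bf.
    exact: (measurable_funD measurable_fst measurable_snd).
  apply/measurable_EFinP; apply: measurable_funB.
    apply: measurable_funM => //; apply: measurable_funM => //.
  exact: measurable_funX.
have J12 := joint_law_eq I1 I2 X12 Y12.
have := integral_same_law J12 mh IG.
by rewrite /gain /Rintegral => ->.
Qed.

End gain_law.

Section noise_reduction.
Context {d} {T : measurableType d} {R : realType} {P : probability T R}.
Variable X : {RV P >-> R}.
Hypothesis IX2 : L1 P (fun w => X w ^+ 2).
Hypothesis EX : (\int[P]_w (X w)%:E = 0)%E.

Let mXfst : @measurable_fun _ _ (T * measurableTypeR R)%type R setT (X \o fst).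
Proof. exact: (measurableT_comp (measurable_funPT X) measurable_fst). Qed.

Definition comp_fst : {mfun (T * measurableTypeR R)%type >-> R} :=
  @mfun_Sub _ _ (T * measurableTypeR R)%type R _ (mem_set mXfst).

(** The gain of f when X is observed through the noise Q(U), U uniform. *)
Definition uniform_gain (Q f : R -> R) : R :=
  gain (with_uniform P) (X \o fst) (fun w => X w.1 + Q w.2) f.

Section extension.
Variable Y : noise P.

Let mlift :
  measurable_fun [set: ext_space (noise_ext Y)] (@lift_rv _ _ _ P X Y).
Proof. exact: measurableT_comp. Qed.

Definition lift_mfun : {mfun ext_space (noise_ext Y) >-> R} :=
  mfun_Sub (mem_set mlift).

Lemma lift_mfun_law (A : set R) : measurable A ->
  P (X @^-1` A) = noise_prob Y (lift_mfun @^-1` A).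
Proof.
by move=> mA; rewrite -(ext_projP (noise_ext Y))//; exact: measurable_funPTI.
Qed.

Lemma lift_L1_sqr : L1 (noise_prob Y) (fun w => lift_mfun w ^+ 2).
Proof.
have mh : measurable_fun [set: R] (fun x : R => (x ^+ 2)%:E).
  by apply/measurable_EFinP; exact: measurable_funX.
exact: (integrable_same_law lift_mfun_law mh IX2).
Qed.

Lemma lift_mean0 : (\int[noise_prob Y]_w (lift_mfun w)%:E = 0)%E.
Proof.
have mh : measurable_fun [set: R] (EFin : R -> \bar R).
  exact: EFin_measurable.
rewrite -EX; apply/esym; apply: (integral_same_law lift_mfun_law mh).
exact: (L1_sqr (measurable_funPT X) IX2).
Qed.

End extension.

Lemma comp_fst_law (A : set R) : measurable A ->
  P (X @^-1` A) = with_uniform P (comp_fst @^-1` A).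
Proof.
by move=> mA; rewrite -with_uniform_fst//; exact: measurable_funPTI.
Qed.

(** Every admissible noise can be replaced by one of the form Q(U): with Q its
    quantile function, Q(U) has the same law and is independent of X, so that
    moments and gains are unchanged.  The variance of the given noise enters
    only as an upper bound for all the gains. *)
Lemma noise_class_quantile (eps : R) (Y : noise P) : noise_class X eps Y ->
  exists Q : R -> R, [/\ @measurable_fun _ _ (measurableTypeR R) R setT Q,
    forall u v, 0 < u -> u <= v -> v < 1 -> Q u <= Q v,
    (\int[@uniform01 R]_u (Q u)%:E = 0)%E,
    (\int[@uniform01 R]_u (Q u ^+ 2)%:E <= (eps ^+ 2)%:E)%E &
    forall f, bounded_continuous f ->
      ((uniform_gain Q f)%:E <= var_cond_exp X Y)%E].
Proof.
move=> [indY]; rewrite !unlock => EY EY2.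
have mY : measurable_fun [set: ext_space (noise_ext Y)] (noise_rv Y).
  exact: measurable_funPT.
pose Q := quantile (noise_rv Y).
have mQ : @measurable_fun _ _ (measurableTypeR R) R setT Q.
  exact: measurable_quantile.
pose q : {mfun measurableTypeR R >-> R} :=
  @mfun_Sub _ _ (measurableTypeR R) R Q (mem_set mQ).
have qY (A : set R) : measurable A ->
    noise_prob Y (noise_rv Y @^-1` A) = @uniform01 R (q @^-1` A).
  by move=> mA; apply/esym; exact: distribution_quantile.
have IY2 : L1 (noise_prob Y) (fun w => noise_rv Y w ^+ 2).
  by apply: L1_sqrP => //; apply: le_lt_trans EY2 _; rewrite ltry.
have IY : L1 (noise_prob Y) (noise_rv Y) by exact: L1_sqr.
exists Q; split => //.
- by move=> u v; exact: quantile_nd.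
- rewrite -[RHS]EY; apply/esym.
  by apply: (integral_same_law qY (@EFin_measurable R setT)).
- have mh : measurable_fun [set: R] (fun x : R => (x ^+ 2)%:E).
    by apply/measurable_EFinP; exact: measurable_funX.
  by rewrite -(ge0_integral_same_law qY mh)// => y; rewrite lee_fin sqr_ge0.
- move=> f bf.
  have mW : measurable_fun setT (lift_mfun Y \+ noise_rv Y).
    exact: measurable_funD.
  have := gain_le_var (measurable_funPT (lift_mfun Y)) mW (@lift_L1_sqr Y)
    (@lift_mean0 Y) bf.
  apply: le_trans; rewrite lee_fin le_eqVlt; apply/orP; left; apply/eqP.
  apply: (gain_same_law bf (X1 := comp_fst) (Y1 := comp_snd mQ)
    (P1 := with_uniform P)).
  + have mh : measurable_fun [set: R] (fun x : R => (x ^+ 2)%:E).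
      by apply/measurable_EFinP; exact: measurable_funX.
    exact: (integrable_same_law comp_fst_law mh IX2).
  + exact: independent_uniform_noise.
  + exact: indY.
  + move=> A mA.
    exact: (etrans (esym (comp_fst_law mA)) (lift_mfun_law Y mA)).
  + by move=> A mA; exact: (etrans (comp_sndE P mQ mA) (esym (qY A mA))).
Qed.

Lemma uniform_noise_class (eps : R) (Q : R -> R)
    (mQ : @measurable_fun _ _ (measurableTypeR R) R setT Q) :
  (\int[@uniform01 R]_u (Q u)%:E = 0)%E ->
  (\int[@uniform01 R]_u (Q u ^+ 2)%:E <= (eps ^+ 2)%:E)%E ->
  noise_class X eps (uniform_noise P mQ).
Proof.
pose q : {mfun measurableTypeR R >-> R} :=
  @mfun_Sub _ _ (measurableTypeR R) R Q (mem_set mQ).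
have qP (A : set R) : measurable A ->
    @uniform01 R (q @^-1` A) = with_uniform P (comp_snd mQ @^-1` A).
  by move=> mA; exact: (esym (comp_sndE P mQ mA)).
move=> EQ EQ2; split; first exact: independent_uniform_noise.
- rewrite unlock -[RHS]EQ; apply/esym.
  apply: (integral_same_law (P1 := @uniform01 R) (Y1 := q) qP
    (@EFin_measurable R setT)).
  apply: L1_sqr => //; apply: L1_sqrP => //.
  by apply: le_lt_trans EQ2 _; rewrite ltry.
- rewrite unlock; apply: le_trans EQ2.
  have mh : measurable_fun [set: R] (fun x : R => (x ^+ 2)%:E).
    by apply/measurable_EFinP; exact: measurable_funX.
  rewrite -(ge0_integral_same_law (P1 := @uniform01 R) (Y1 := q) qP mh)//.
  by move=> y; rewrite lee_fin sqr_ge0.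
Qed.

Lemma var_uniform_noise_le (Q : R -> R)
    (mQ : @measurable_fun _ _ (measurableTypeR R) R setT Q) (c : R) :
  (forall f, bounded_continuous f -> uniform_gain Q f <= c) ->
  (var_cond_exp X (uniform_noise P mQ) <= c%:E)%E.
Proof.
move=> gc; pose Y := uniform_noise P mQ.
have mW : measurable_fun [set: ext_space (noise_ext Y)]
    (lift_mfun Y \+ noise_rv Y) by exact: measurable_funD.
exact: (var_le_gain (measurable_funPT (lift_mfun Y)) mW (@lift_L1_sqr Y)
    (@lift_mean0 Y) gc).
Qed.

(** Dominated convergence: with |f| <= M, the integrand is at most
    2 M |X| + M^2 in absolute value, which is integrable. *)
Lemma uniform_gain_cvg (q : nat -> R -> R) (Q f : R -> R) :
  (forall n, @measurable_fun _ _ (measurableTypeR R) R setT (q n)) ->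
  @measurable_fun _ _ (measurableTypeR R) R setT Q ->
  {ae @uniform01 R, forall u, q n u @[n --> \oo] --> Q u} ->
  bounded_continuous f ->
  uniform_gain (q n) f @[n --> \oo] --> uniform_gain Q f.
Proof.
move=> mq mQ qQ bf; have [cf [M fM]] := bf.
have M0 : 0 <= M by apply: le_trans (fM 0).
have mE (p : R -> R) : @measurable_fun _ _ (measurableTypeR R) R setT p ->
    measurable_fun [set: (T * measurableTypeR R)%type]
      (fun w => 2 * (X w.1 * f (X w.1 + p w.2)) - f (X w.1 + p w.2) ^+ 2).
  move=> mp.
  have mfp : measurable_fun [set: (T * measurableTypeR R)%type]
      (fun w => f (X w.1 + p w.2)).
    apply: measurableT_comp; first exact: continuous_measurable_fun.
    apply: measurable_funD => //.
    exact: (measurableT_comp mp measurable_snd).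
  apply: measurable_funB; last exact: measurable_funX.
  by apply: measurable_funM => //; apply: measurable_funM.
apply: (@Rint_dominated_cvg _ _ _ (with_uniform P) (fun n w =>
    2 * (X w.1 * f (X w.1 + q n w.2)) - f (X w.1 + q n w.2) ^+ 2) _
    (fun w => 2 * M * `|X w.1| + M ^+ 2) _ _ _ _ _).2.
- by move=> n; exact: mE.
- exact: mE.
- apply: L1D; last exact: L1_cst.
  apply: L1Z; apply: integrable_norm.
  exact: (integrable_same_law comp_fst_law (@EFin_measurable R setT)
    (L1_sqr (measurable_funPT X) IX2)).
- move=> n w; apply: (le_trans (ler_normB _ _)).
  have fw := fM (X w.1 + q n w.2).
  rewrite normrX !normrM (ger0_norm (ler0n R 2)) -mulrA; apply: lerD.
    by rewrite ler_wpM2l// mulrC ler_wpM2r.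
  by rewrite lerXn2r ?nnegrE.
- have [N [mN N0 NQ]] := qQ.
  exists (snd @^-1` N); split.
  + by rewrite -[_ @^-1` _]setTI; exact: measurable_snd.
  + exact: (etrans (with_uniform_snd P mN) N0).
  + move=> w /= h; apply: NQ => /= qw; apply: h.
    have fqw : f (X w.1 + q n w.2) @[n --> \oo] --> f (X w.1 + Q w.2).
      have c2 : X w.1 + q n w.2 @[n --> \oo] --> X w.1 + Q w.2.
        by apply: cvgD; [exact: cvg_cst|exact: qw].
      exact: (continuous_cvg _ (cf (X w.1 + Q w.2)) c2).
    apply: cvgB.
      apply: cvgM; first exact: cvg_cst.
      by apply: cvgM; [exact: cvg_cst|exact: fqw].
    rewrite expr2; under eq_fun do rewrite expr2.
    exact: (cvgM fqw fqw).
Qed.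

End noise_reduction.

Local Open Scope ereal_scope.

Theorem theorem4 (d : measure_display) (T : measurableType d) (R : realType)
    (P : probability T R) (X : {RV P >-> R}) (eps : R) :
  (0 <= eps)%R ->
  nondegenerate_rv P X ->
  'E_P[X] = 0 ->
  'E_P[fun w => (X w ^+ 2)%R] < +oo ->
  exists Y : noise P, least_favorable X eps Y.
Proof.
move=> _ _; rewrite !unlock => EX EX2.
have IX2 : L1 P (fun w => X w ^+ 2)%R by exact: L1_sqrP.
pose S := [set v | exists2 Z : noise P, noise_class X eps Z &
                                         v = var_cond_exp X Z].
have m0 : @measurable_fun _ _ (measurableTypeR R) R setT (fun=> 0%R).
  exact: measurable_cst.
(* The noise 0 is admissible. *)
have S0 : S !=set0.
  exists (var_cond_exp X (uniform_noise P m0)).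
  exists (uniform_noise P m0) => //.
  apply: uniform_noise_class; first by rewrite integral0.
  under eq_integral do rewrite expr0n.
  by rewrite integral0 lee_fin sqr_ge0.
have [v vS vL] := ereal_inf_seq ((set0P _).2 S0).
have /choice[q qP] n : exists Q : R -> R, [/\
    @measurable_fun _ _ (measurableTypeR R) R setT Q,
    forall u v, (0 < u -> u <= v -> v < 1 -> Q u <= Q v)%R,
    \int[@uniform01 R]_u (Q u)%:E = 0,
    \int[@uniform01 R]_u (Q u ^+ 2)%:E <= (eps ^+ 2)%:E &
    forall f, bounded_continuous f -> (uniform_gain X Q f)%:E <= v n].
  have [Z Zc ->] := vS n.
  exact: noise_class_quantile.
have mq n : @measurable_fun _ _ (measurableTypeR R) R setT (q n).
  by have [] := qP n.
(* Pointwise boundedness follows from |x| <= 1 + x^2. *)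
have [||phi [Q [phin mQ qQ]]] := helly_selection mq.
- by move=> n; have [] := qP n.
- move=> u u01; exists (1 + eps ^+ 2 / (u * (1 - u)))%R => n.
  have [_ nd _ q2 _] := qP n.
  have := nondecreasing_pointwise_bound (mq n) nd q2 u01.
  have u10 : (0 < u * (1 - u))%R by case/andP: u01 => *; nra.
  rewrite -ler_pdivlMr// => h.
  apply: (@le_trans _ _ (1 + q n u ^+ 2)%R); last by rewrite lerD2l.
  have := sqr_ge0 (`|q n u| - 1)%R; have := normr_ge0 (q n u).
  rewrite -(real_normK (num_real (q n u))); nra.
have [EQ2 EQ] : \int[@uniform01 R]_u (Q u ^+ 2)%:E <= (eps ^+ 2)%:E /\
    \int[@uniform01 R]_u (Q u)%:E = 0.
  apply: (@moments_limit _ (measurableTypeR R) R (@uniform01 R)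
    (fun n => q (phi n)) Q (eps ^+ 2)%R (fun n => mq (phi n)) mQ) => //.
  - by move=> n; have [] := qP (phi n).
  - by move=> n; have [] := qP (phi n).
exists (uniform_noise P mQ).
have cQ : noise_class X eps (uniform_noise P mQ) by exact: uniform_noise_class.
split => //; apply/eqP; rewrite eq_le; apply/andP; split; last first.
  by apply: ereal_inf_lbound; exists (uniform_noise P mQ).
rewrite /least_var_cond_exp -/S.
have L0 : 0 <= ereal_inf S.
  by apply: le_ereal_inf_tmp => _ [Z _ ->]; exact: variance_ge0.
(* If the infimum is +oo, every admissible noise attains it. *)
have [Loo|Loo] := eqVneq (ereal_inf S) +oo; first by rewrite Loo leey.
have Lfin : ereal_inf S \is a fin_num by rewrite ge0_fin_numE// ltey.
rewrite -(fineK Lfin); apply: var_uniform_noise_le => // f bf.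
rewrite -lee_fin (fineK Lfin).
have gcvg : (uniform_gain X (q (phi n)) f)%:E @[n --> \oo] -->
    (uniform_gain X Q f)%:E.
  apply: cvg_EFin; first exact: nearW.
  by apply: uniform_gain_cvg.
have vphi : v (phi n) @[n --> \oo] --> ereal_inf S.
  apply: (cvg_comp _ _ _ vL).
  move=> A [N _ NA]; exists N => // n /= Nn; apply: NA => /=.
  exact: leq_trans Nn (phin n).
have : limn (fun n => (uniform_gain X (q (phi n)) f)%:E) <=
    limn (fun n => v (phi n)).
  apply: lee_lim; [exact: cvgP gcvg|exact: cvgP vphi|].
  by apply: nearW => n; have [_ _ _ _ /(_ _ bf)] := qP (phi n).
rewrite (cvg_lim _ gcvg)//; rewrite (cvg_lim _ vphi)//.
Qed.
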